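(* The following two assertions hold. (i) Let $\kappa:\mathcal C\to\mathbb R$ be a measure of concordance of degree at most two, with canonical polarization $b_\kappa$. Then there is a unique admissible field $\nu^\kappa=(\nu^\kappa_C)_{C\in\mathcal C}$ such that, for all $C,D\in\mathcal C$, $$b_\kappa(C,D)=\int_{(0,1)^2}(C-\Pi)\,\mathrm d\nu^\kappa_\Pi+\int_{(0,1)^2}(D-\Pi)\,\mathrm d\nu^\kappa_C. \qquad ( * )$$ (ii) Conversely, let $\nu=(\nu_C)_{C\in\mathcal C}$ be an admissible field, and define $\kappa_\nu:\mathcal C\to\mathbb R$ by $$\kappa_\nu(C)=\int_{(0,1)^2}(C-\Pi)\,\mathrm d\nu_\Pi+\int_{(0,1)^2}(C-\Pi)\,\mathrm d\nu_C .$$ Then $\kappa_\nu$ is a measure of concordance of degree at most two. In addition, its canonical polarization is $$b_{\kappa_\nu}(C,D)=\int_{(0,1)^2}(C-\Pi)\,\mathrm d\nu_\Pi+\int_{(0,1)^2}(D-\Pi)\,\mathrm d\nu_C,\qquad C,D\in\mathcal C,$$ and the unique admissible field associated with $\kappa_\nu$ by (i) is $\nu$, i.e. $\nu^{\kappa_\nu}=\nu$.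
   Context: $\mathcal C$ is the set of all bivariate copulas, with the uniform topology; $\mu_C$ is the Borel probability measure on $[0,1]^2$ associated with $C\in\mathcal C$. $M(u,v)=\min(u,v)$, $W(u,v)=\max(u+v-1,0)$, $\Pi(u,v)=uv$. $C\preceq D$ means $C(u,v)\le D(u,v)$ for all $(u,v)\in[0,1]^2$. $\mathcal D_4$ is the (8-element) symmetry group of $[0,1]^2$ generated by $\pi(u,v)=(v,u)$ and $\sigma_1(u,v)=(1-u,v)$ under composition. For $\gamma\in\mathcal D_4$ and $C\in\mathcal C$, $C^\gamma$ is the copula with $\mu_{C^\gamma}=\gamma_\#\mu_C$, where $\gamma_\#\mu(A)=\mu(\gamma^{-1}(A))$. A functional $\kappa:\mathcal C\to\mathbb R$ is a measure of concordance if: (A1) $\kappa(C^\pi)=\kappa(C)$ for every $C$; (A2) $C\preceq D$ implies $\kappa(C)\le\kappa(D)$; (A3) $\kappa(M)=1$; (A4) $\kappa(C^{\sigma_1})=-\kappa(C)$ for every $C$; (A5) $C_n\to C$ uniformly implies $\kappa(C_n)\to\kappa(C)$. $\kappa:\mathcal C\to\mathbb R$ has degree at most two if for every $C,D\in\mathcal C$ the map $t\mapsto\kappa((1-t)C+tD)$ agrees on $[0,1]$ with a real polynomial of degree at most two. The canonical polarization of $\kappa$ is $b_\kappa(C,D)=2\kappa\left(\frac{C+D}{2}\right)-\frac{\kappa(C)+\kappa(D)}{2}$, $C,D\in\mathcal C$. Let $w=M-W$, i.e. $w(u,v)=\min\{u,v,1-u,1-v\}$. $\mathfrak M_w^+$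 is the set of non-negative Borel measures $\nu$ on $(0,1)^2$ with $\int_{(0,1)^2}w\,\mathrm d\nu<\infty$ (total mass may be infinite). Since $|C-\Pi|\le w$ for every copula $C$, integrals of $C-\Pi$ against such measures are finite. For $\nu,\tilde\nu\in\mathfrak M_w^+$ and a function $f$ with $|f|\le Kw$ for some $K>0$, $\int f\,\mathrm d(\nu-\tilde\nu)$ means $\int f\,\mathrm d\nu-\int f\,\mathrm d\tilde\nu$. A field $\nu=(\nu_C)_{C\in\mathcal C}$ of measures is admissible if: (P1) $\nu_C\in\mathfrak M_w^+$ for every $C\in\mathcal C$; (P2) $\nu_{(1-t)C+tD}=(1-t)\nu_C+t\nu_D$ for all $C,D\in\mathcal C$, $0\le t\le1$; (P3) $\int_{(0,1)^2}(D-\Pi)\,\mathrm d(\nu_C-\nu_\Pi)=\int_{(0,1)^2}(C-\Pi)\,\mathrm d(\nu_D-\nu_\Pi)$ for all $C,D\in\mathcal C$; (P4) $\nu_{C^\gamma}=\gamma_\#\nu_C$ for all $C\in\mathcal C$, $\gamma\in\mathcal D_4$; (P5) the map $\zeta_\nu(C)=\int_{(0,1)^2}(C-\Pi)\,\mathrm d\nu_\Pi+\int_{(0,1)^2}(C-\Pi)\,\mathrm d\nu_C$ is continuous on $\mathcal C$; (P6) $\int_{(0,1)^2}(M-\Pi)\,\mathrm d\nu_\Pi+\int_{(0,1)^2}(M-\Pi)\,\mathrm d\nu_M=1$. *)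

(* Defs.v *)
From HB Require Import structures.
From mathcomp Require Import all_boot all_order all_algebra.
From mathcomp Require Import all_classical all_reals all_analysis.
From mathcomp Require Import lra.

Set Implicit Arguments.
Unset Strict Implicit.
Unset Printing Implicit Defensive.

Import Order.TTheory GRing.Theory Num.Theory.
Import numFieldNormedType.Exports.

Local Open Scope classical_set_scope.
Local Open Scope ring_scope.

Definition unit_square (R : realType) : set (R * R) :=
  [set p | 0 <= p.1 <= 1 /\ 0 <= p.2 <= 1].

Definition open_square (R : realType) : set (R * R) :=
  [set p | 0 < p.1 < 1 /\ 0 < p.2 < 1].

Arguments unit_square {R}.
Arguments open_square {R}.

(* A function on [0,1]^2 is encoded as a function on R^2 that vanishes off
   [0,1]^2, so that Leibniz equality of copulas is equality on [0,1]^2. *)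
Record is_copula (R : realType) (C : R * R -> R) : Prop := IsCopula {
  copula_off : forall p, ~ unit_square p -> C p = 0 ;
  copula_grounded : forall u, 0 <= u <= 1 -> C (u, 0) = 0 /\ C (0, u) = 0 ;
  copula_margins : forall u, 0 <= u <= 1 -> C (u, 1) = u /\ C (1, u) = u ;
  copula_2increasing : forall u u' v v',
    0 <= u -> u <= u' -> u' <= 1 -> 0 <= v -> v <= v' -> v' <= 1 ->
    0 <= C (u', v') - C (u', v) - C (u, v') + C (u, v) }.

Record copula (R : realType) := Copula {
  copula_fun :> R * R -> R ;
  copulaP : is_copula copula_fun }.

Section copula_basics.
Context {R : realType}.
Implicit Types (C D : copula R) (p : R * R).

Lemma copula_ext C D : (forall p, unit_square p -> C p = D p) -> C = D.
Proof.
case: C D => [f fP] [g gP] /= fg; have efg : f = g.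
  apply/funext => p; have [/fg//|np] := pselect (unit_square p).
  by rewrite (copula_off fP np) (copula_off gP np).
by case: _ / efg gP {fg} => gP; rewrite (Prop_irrelevance fP gP).
Qed.

Definition on_square (f : R * R -> R) p : R :=
  if p \in unit_square then f p else 0.

Lemma on_squareE f u v : 0 <= u <= 1 -> 0 <= v <= 1 ->
  on_square f (u, v) = f (u, v).
Proof. by move=> u01 v01; rewrite /on_square mem_set. Qed.

Lemma on_square_off f p : ~ unit_square p -> on_square f p = 0.
Proof. by move=> np; rewrite /on_square memNset. Qed.

Let unitE (x : R) : 0 <= x -> x <= 1 -> 0 <= x <= 1.
Proof. by move=> -> ->. Qed.

Lemma M_is_copula : is_copula (on_square (fun p => Num.min p.1 p.2)).
Proof.
split=> [p|u u01|u u01|u u' v v' u0 uu' u'1 v0 vv' v'1].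
- exact: on_square_off.
- move: (u01) => /andP[u0 u1].
  by rewrite !on_squareE ?lexx ?ler01//= min_r// min_l.
- move: (u01) => /andP[u0 u1].
  by rewrite !on_squareE ?lexx ?ler01//= min_l// min_r.
- rewrite !on_squareE /=; try (apply: unitE; lra).
  by rewrite !minEle; do ![case: ifPn; rewrite -?ltNge => ?]; lra.
Qed.

Lemma W_is_copula : is_copula (on_square (fun p => Num.max (p.1 + p.2 - 1) 0)).
Proof.
split=> [p|u u01|u u01|u u' v v' u0 uu' u'1 v0 vv' v'1].
- exact: on_square_off.
- move: (u01) => /andP[u0 u1].
  by rewrite !on_squareE ?lexx ?ler01//= !max_r//; lra.
- move: (u01) => /andP[u0 u1].
  by rewrite !on_squareE ?lexx ?ler01//= !max_l//; lra.
- rewrite !on_squareE /=; try (apply: unitE; lra).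
  by rewrite !maxEle; do ![case: ifPn; rewrite -?ltNge => ?]; lra.
Qed.

Lemma Pi_is_copula : is_copula (on_square (fun p => p.1 * p.2)).
Proof.
split=> [p|u u01|u u01|u u' v v' u0 uu' u'1 v0 vv' v'1].
- exact: on_square_off.
- by rewrite !on_squareE ?lexx ?ler01//= mulr0 mul0r.
- by rewrite !on_squareE ?lexx ?ler01//= mulr1 mul1r.
- rewrite !on_squareE /=; try (apply: unitE; lra).
  by have := mulr_ge0 (_ : 0 <= u' - u) (_ : 0 <= v' - v); lra.
Qed.

Lemma conv_is_copula (t : R) (t01 : 0 <= t <= 1) C D :
  is_copula (fun p => (1 - t) * C p + t * D p).
Proof.
case: C D => [f [f1 f2 f3 f4]] [g [g1 g2 g3 g4]] /=; split.
- by move=> p np; rewrite f1// g1// !mulr0 addr0.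
- by move=> u /[dup] /f2[-> ->] /g2[-> ->]; rewrite !mulr0 addr0.
- by move=> u /[dup] /f3[-> ->] /g3[-> ->]; split; lra.
- move=> u u' v v' u0 uu' u'1 v0 vv' v'1.
  have := f4 _ _ _ _ u0 uu' u'1 v0 vv' v'1.
  have := g4 _ _ _ _ u0 uu' u'1 v0 vv' v'1.
  move: t01 => /andP[t0 t1] gp fp.
  have := mulr_ge0 t0 gp; have := mulr_ge0 (_ : 0 <= 1 - t) fp; lra.
Qed.

Lemma half01 : 0 <= (2^-1 : R) <= 1.
Proof. lra. Qed.

Definition cop_M : copula R := Copula M_is_copula.
Definition cop_W : copula R := Copula W_is_copula.
Definition cop_Pi : copula R := Copula Pi_is_copula.

Definition cop_conv (t : R) (t01 : 0 <= t <= 1) C D : copula R :=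
  Copula (conv_is_copula t01 C D).

Definition cop_mid C D : copula R := cop_conv half01 C D.

Lemma cop_midE C D p : cop_mid C D p = (C p + D p) / 2.
Proof. by rewrite /=; lra. Qed.

Definition cop_le C D : Prop := forall p, unit_square p -> C p <= D p.

End copula_basics.

HB.instance Definition _ (R : realType) := gen_eqMixin (copula R).
HB.instance Definition _ (R : realType) := gen_choiceMixin (copula R).

Definition copula_uniform (R : realType) (C : copula R) :
  {uniform` @unit_square R -> R} := (C : R * R -> R).

HB.instance Definition _ (R : realType) :=
  Uniform.copy (copula R) (initial_topology (@copula_uniform R)).

Section copula_measure.
Context {R : realType}.
Implicit Types (C D : copula R) (g : R * R -> R * R).

(* Borel measures on [0,1]^2 or (0,1)^2 are Borel measures on R^2 that give
   no mass to the complement; here concentration on [0,1]^2 follows from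
   C (1, 1) = 1. *)
Definition is_measure_of C (P : probability (R * R)%type R) : Prop :=
  forall u v, 0 <= u <= 1 -> 0 <= v <= 1 ->
    P (`[0, u] `*` `[0, v]) = (C (u, v))%:E.

(* The Dirac mass is only the default of the choice operator. *)
Definition mu_ C : probability (R * R)%type R :=
  xget (\d_ ((0, 0) : R * R) : probability (R * R)%type R)
    [set P | is_measure_of C P].

Definition swap_sym (p : R * R) : R * R := (p.2, p.1).
Definition flip_sym (p : R * R) : R * R := (1 - p.1, p.2).

(* Inverses need not be added: both generators are involutions. *)
Inductive D4 : (R * R -> R * R) -> Prop :=
| D4_id : D4 id
| D4_swap : D4 swap_sym
| D4_flip : D4 flip_sym
| D4_comp g1 g2 : D4 g1 -> D4 g2 -> D4 (g1 \o g2).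

(* The copula C^g; for g in D4 the default C is never used. *)
Definition cop_sym g C : copula R :=
  xget C [set D | forall A : set (R * R), measurable A ->
                    mu_ D A = pushforward (mu_ C) g A].

End copula_measure.

Section concordance.
Context {R : realType}.
Implicit Types (C D : copula R) (kappa : copula R -> R).

Record concordance_measure kappa : Prop := ConcordanceMeasure {
  conc_swap : forall C, kappa (cop_sym swap_sym C) = kappa C ;
  conc_le : forall C D, cop_le C D -> kappa C <= kappa D ;
  conc_M : kappa cop_M = 1 ;
  conc_flip : forall C, kappa (cop_sym flip_sym C) = - kappa C ;
  conc_cvg : forall (C_ : nat -> copula R) C,
    {uniform unit_square, (fun n => C_ n : R * R -> R) @ \oo
                            --> (C : R * R -> R)} ->
    kappa (C_ n) @[n --> \oo] --> kappa C }.

Definition degree_le2 kappa : Prop :=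
  forall C D, exists p : {poly R}, (size p <= 3)%N /\
    forall t (t01 : 0 <= t <= 1), kappa (cop_conv t01 C D) = p.[t].

Definition polarization kappa C D : R :=
  2 * kappa (cop_mid C D) - (kappa C + kappa D) / 2.

End concordance.

Section fields.
Context {R : realType}.

Local Notation measureR2 := {measure set (R * R) -> \bar R}.
Local Notation field := (copula R -> measureR2).

Implicit Types (C D : copula R) (m : measureR2) (nu : field).

Definition cop_w (p : R * R) : R := cop_M p - cop_W p.

Lemma cop_wE u v : 0 <= u <= 1 -> 0 <= v <= 1 ->
  cop_w (u, v) = Num.min (Num.min u v) (Num.min (1 - u) (1 - v)).
Proof.
move=> u01 v01; rewrite /cop_w /= !on_squareE//=.
move: u01 v01 => /andP[u0 u1] /andP[v0 v1].
by case: (leP u v) => ?; case: (leP (1 - u) (1 - v)) => ?; case: leP => ?;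
  case: leP => ?; lra.
Qed.

Definition weighted_measure m : Prop :=
  m (~` open_square) = 0%E /\
  (\int[m]_(p in open_square) (cop_w p)%:E < +oo)%E.

Definition int_cop C m : R := \int[m]_(p in open_square) (C p - cop_Pi p).

Definition zeta nu C : R := int_cop C (nu cop_Pi) + int_cop C (nu C).

Record admissible nu : Prop := Admissible {
  adm_weighted : forall C, weighted_measure (nu C) ;
  adm_affine : forall C D t (t01 : 0 <= t <= 1) (A : set (R * R)),
    measurable A ->
    nu (cop_conv t01 C D) A = ((1 - t)%:E * nu C A + t%:E * nu D A)%E ;
  adm_sym : forall C D,
    int_cop D (nu C) - int_cop D (nu cop_Pi) =
    int_cop C (nu D) - int_cop C (nu cop_Pi) ;
  adm_D4 : forall C g, D4 g -> forall A : set (R * R), measurable A ->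
    nu (cop_sym g C) A = pushforward (nu C) g A ;
  adm_continuous : continuous (zeta nu) ;
  adm_norm : zeta nu cop_M = 1 }.

Definition represents nu kappa : Prop :=
  forall C D,
    polarization kappa C D = int_cop C (nu cop_Pi) + int_cop D (nu C).

(* A measure is a function on all sets, arbitrary on non-measurable ones. *)
Definition field_eq nu nu' : Prop :=
  forall C (A : set (R * R)), measurable A -> nu C A = nu' C A.

Definition unique_field_of kappa nu : Prop :=
  [/\ admissible nu, represents nu kappa &
      forall nu', admissible nu' -> represents nu' kappa -> field_eq nu' nu].

End fields.

(* Main.v *)
(** A functional of degree at most two is determined by its canonical
    polarization b, which is symmetric and affine in each argument, and b(C, .)
    inherits monotonicity and continuity from kappa.  Everything rests on the
    following representation: a monotone, continuous affine functional L on
    copulas is, up to a constant, D |-> int (D - Pi) dm for a unique measure m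
    on the open square with int w dm < oo.

    Existence is a Daniell-type construction.  The functions a (D - E) with
    a >= 0 and D >= E carry the cost a (L D - L E); covering indicators by
    countable sums of such functions at least cost defines an outer measure.
    Half-planes are Caratheodory measurable, because multiplying D - E by a
    Lipschitz cutoff of one coordinate gives again a multiple of a difference of
    copulas.  For compactly supported D - E Dini's theorem identifies the
    integral with the cost; the general case follows by patching a rescaled copy
    of the copula into Pi, the continuity of L, and dominated convergence with
    bound w.  Uniqueness: a competitor is dominated by m on every Borel set, and
    gives w the same finite integral.

    The same outer measure, built on half-open rectangles with the volume of C
    as cost, yields mu_C, hence the explicit form of the copulas C^gamma.  The
    properties (P2) and (P4) then follow from the uniqueness of the representing
    measures, and (P3) from the symmetry of b. *)
Require Import Defs.
From HB Require Import structures.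
From mathcomp Require Import all_boot all_order all_algebra.
From mathcomp Require Import all_classical all_reals all_analysis.
From mathcomp Require Import measurable_realfun ring lra.

Set Implicit Arguments.
Unset Strict Implicit.
Unset Printing Implicit Defensive.

Import Order.TTheory GRing.Theory Num.Theory.
Import numFieldNormedType.Exports.

Local Open Scope classical_set_scope.
Local Open Scope ring_scope.

Lemma measureI_null {d} {T : measurableType d} {R : realType}
    (m : {measure set T -> \bar R}) (S A : set T) :
  measurable S -> measurable A -> m (~` S) = 0%E -> m A = m (A `&` S).
Proof.
move=> mS mA mS0.
have mSc : measurable (~` S) by exact: measurableC.
rewrite -[in LHS](setIT A) -(setUv S) setIUr measureU//; last 3 first.
- exact: measurableI.
- exact: measurableI.
- by rewrite setIACA setICr setI0.
rewrite [X in (_ + X)%E](_ : _ = 0%E) ?adde0//.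
by apply/le_anti; rewrite measure_ge0 andbT -mS0 le_measure// ?inE//; exact: measurableI.
Qed.

(** * Outer measures from weighted covers *)
Section upper_integral.
Context {R : realType} {I : Type}.
Variables (fn : I -> R * R -> R) (cost : I -> R) (S : set (R * R)).
Hypothesis fn_ge0 : forall i p, 0 <= fn i p.
Hypothesis cost_ge0 : forall i, 0 <= cost i.
Hypothesis zero_index : exists2 i0, (forall p, fn i0 p = 0) & cost i0 = 0.
Implicit Types (phi psi : R * R -> R) (A H : set (R * R)) (s : nat -> I).

Definition covers phi s :=
  forall p, S p -> ((phi p)%:E <= \sum_(k <oo) (fn (s k) p)%:E)%E.

(** A Daniell upper integral, restricting on indicators to an outer measure. Covers are tested on
    [S] only, so the complement of [S] is null. *)
Definition upint phi : \bar R :=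
  ereal_inf [set (\sum_(k <oo) (cost (s k))%:E)%E | s in covers phi].

(** The Caratheodory condition, required of the generators only; [splits_upint] extends it to all
    non-negative functions. *)
Definition splits H := forall i,
  (upint (fun p => (fn i p * \1_H p)%R) + upint (fun p => (fn i p * \1_(~` H) p)%R)
   <= (cost i)%:E)%E.

Lemma nneseries_pair (a : nat -> nat -> \bar R) (f : nat -> nat * nat) :
  (forall n m, 0 <= a n m)%E -> set_bij setT setT f ->
  (\sum_(n <oo) \sum_(m <oo) a n m = \sum_(k <oo) a (f k).1 (f k).2)%E.
Proof.
move=> a0 bf.
rewrite (@nneseries_esumT _ (fun n => \sum_(m <oo) a n m)%E); last first.
  by move=> n; apply: nneseries_ge0.
rewrite (eq_esum (fun n _ => nneseries_esumT (a0 n))) esum_esum//.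
rewrite nneseries_esumT; last by move=> n; exact: a0.
rewrite (_ : [set: nat] `*`` (fun=> setT) = setT); last by apply/seteqP; split.
exact: reindex_esum.
Qed.

Lemma upint_ge0 phi : (0 <= upint phi)%E.
Proof.
by apply: le_ereal_inf_tmp => _ [s _ <-]; apply: nneseries_ge0 => k _ _; rewrite lee_fin.
Qed.

Lemma upint_le_cover phi s : covers phi s ->
  (upint phi <= \sum_(k <oo) (cost (s k))%:E)%E.
Proof. by move=> cs; apply: ereal_inf_lbound; exists s. Qed.

Lemma upint_fn_le i phi : (forall p, S p -> phi p <= fn i p) ->
  (upint phi <= (cost i)%:E)%E.
Proof.
have [i0 f0 c0] := zero_index.
have sum1 (g : I -> R) : (forall i, 0 <= g i) -> g i0 = 0 ->
    (\sum_(k <oo) (g (if k is 0%N then i else i0))%:E = (g i)%:E)%E.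
  move=> g0 gi0; rewrite nneseries_recl//; last by move=> k; rewrite lee_fin.
  rewrite [X in (_ + X)%E](_ : _ = 0%E) ?adde0// eseries_cond/= eseries0// => -[|k]//= _ _.
  by rewrite gi0.
move=> le; have := @upint_le_cover phi (fun k => if k is 0%N then i else i0).
rewrite sum1//; apply=> p Sp; rewrite (sum1 (fn ^~ p)) ?lee_fin//; exact: le.
Qed.

(** Nearly optimal covers of the [psi n], with errors summing to [e], are merged into a single cover
    along an enumeration of the pairs of naturals. *)
Lemma upint_sigma_subadditive phi (psi : nat -> R * R -> R) :
  (forall p, S p -> (phi p)%:E <= \sum_(n <oo) (psi n p)%:E)%E ->
  (forall n p, 0 <= psi n p) ->
  (upint phi <= \sum_(n <oo) upint (psi n))%E.
Proof.
move=> le_phi psi0; have [[i ioo]|] := pselect (exists i, upint (psi i) = +oo%E).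
  by rewrite (nneseries_pinfty _ _ ioo) ?leey// => n _; exact: upint_ge0.
rewrite -forallNE => psioo.
suff add2e (e : {posnum R}) :
    (upint phi <= \sum_(n <oo) upint (psi n) + e%:num%:E)%E.
  by apply/lee_addgt0Pr => _/posnumP[].
rewrite (le_trans _ (epsilon_trick _ _ _))//; last by move=> n; exact: upint_ge0.
have [s Ps] : {s : nat -> nat -> I & forall n, covers (psi n) (s n) /\
    (\sum_(k <oo) (cost (s n k))%:E <=
       upint (psi n) + (e%:num / (2 ^ n.+1)%:R)%:E)%E}.
  apply: (@choice _ _ (fun n s => covers (psi n) s /\ (\sum_(k <oo) (cost (s k))%:E <=
       upint (psi n) + (e%:num / (2 ^ n.+1)%:R)%:E)%E)) => n.
  have en1 : 0 < e%:num / (2 ^ n.+1)%:R :> R by [].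
  have /(lb_ereal_inf_adherent en1)[_ [s cs <-] lts] : upint (psi n) \is a fin_num.
    by rewrite ge0_fin_numE ?upint_ge0// ltey; exact/eqP/psioo.
  by exists s; split => //; exact: ltW.
have /card_esym/ppcard_eqP[f] := card_nat2.
have bf : set_bij setT setT f by exact: bij.
pose s' k := s (f k).1 (f k).2.
apply: le_trans (upint_le_cover (_ : covers phi s')) _.
  move=> p Sp; apply: le_trans (le_phi p Sp) _.
  have := nneseries_pair (a := fun n m => (fn (s n m) p)%:E) _ bf => /= <-;
    last by move=> n m; rewrite lee_fin.
  apply: lee_nneseries => [n _ _|n _]; first by rewrite lee_fin.
  by have [+ _] := Ps n; exact.
have := nneseries_pair (a := fun n m => (cost (s n m))%:E) _ bf => /= <-;
  last by move=> n m; rewrite lee_fin.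
apply: lee_nneseries => [n _ _|n _]; last by have [] := Ps n.
by apply: nneseries_ge0 => k _ _; rewrite lee_fin.
Qed.

Lemma le_upint phi psi : (forall p, S p -> phi p <= psi p) ->
  (upint phi <= upint psi)%E.
Proof.
move=> le; apply: le_ereal_inf_tmp => _ [s cs <-]; apply: upint_le_cover => p Sp.
by apply: le_trans (cs p Sp); rewrite lee_fin le.
Qed.

Lemma eq_upint phi psi : (forall p, S p -> phi p = psi p) ->
  upint phi = upint psi.
Proof. by move=> e; apply/le_anti/andP; split; apply: le_upint => p /e ->. Qed.

Lemma upint_eq0 phi : (forall p, S p -> phi p <= 0) -> upint phi = 0%E.
Proof.
have [i0 f0 c0] := zero_index => phi0; apply/le_anti/andP; split; last exact: upint_ge0.
by have := @upint_fn_le i0 phi; rewrite c0; apply=> p Sp; rewrite f0 phi0.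
Qed.

(** A cover of [phi], multiplied by the indicators of [H] and of its complement, bounds both halves
    by countable subadditivity; the generator inequalities are then added up. *)
Lemma splits_upint H phi : (forall p, 0 <= phi p) -> splits H ->
  (upint (fun p => (phi p * \1_H p)%R) + upint (fun p => (phi p * \1_(~` H) p)%R)
   <= upint phi)%E.
Proof.
move=> phi0 sH; apply: le_ereal_inf_tmp => _ [s cs <-].
have le K : (upint (fun p => (phi p * \1_K p)%R) <=
    \sum_(k <oo) upint (fun p => (fn (s k) p * \1_K p)%R))%E.
  apply: upint_sigma_subadditive => [p Sp|n p]; last by rewrite mulr_ge0.
  rewrite indicE; case: (p \in K) => /=.
    rewrite mulr1; under eq_eseriesr do rewrite mulr1; exact: cs.
  by rewrite mulr0 eseries0// => k _ _; rewrite mulr0.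
apply: le_trans (leeD (le H) (le (~` H))) _.
rewrite -nneseriesD; [|by move=> *; exact: upint_ge0|by move=> *; exact: upint_ge0].
by apply: lee_nneseries => [n _ _|n _//]; rewrite adde_ge0 ?upint_ge0.
Qed.

Hypothesis splits1 : forall a, splits [set p | a < p.1].
Hypothesis splits2 : forall a, splits [set p | a < p.2].

(** A general [phi] gives a measure that plays the role of density [phi] before any integral is
    computed; [phi = 1] gives the basic measure. *)
Lemma upint_measure phi : (forall p, 0 <= phi p) ->
  exists m : {measure set (R * R) -> \bar R},
    forall A, m A = upint (fun p => phi p * \1_A p).
Proof.
move=> phi0; pose mu A := upint (fun p => phi p * \1_A p).
have mu0 : mu set0 = 0%E.
  by apply: upint_eq0 => p _; rewrite indic0 mulr0.
have mu_ge0 A : (0 <= mu A)%E by exact: upint_ge0.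
have le_mu : {homo mu : A B / A `<=` B >-> (A <= B)%E}.
  move=> A B AB; apply: le_upint => p _; rewrite !indicE ler_wpM2l// ler_nat.
  by case: (boolP (p \in A)) => //; rewrite !inE => /AB Bp; rewrite mem_set.
have mu_sub : sigma_subadditive mu.
  move=> F; apply: upint_sigma_subadditive => [p Sp|n p]; last by rewrite mulr_ge0.
  have s0 : (0 <= \sum_(n <oo) (phi p * \1_(F n) p)%:E)%E.
    by apply: nneseries_ge0 => n _ _; rewrite lee_fin mulr_ge0.
  rewrite [in leLHS]indicE; case: (boolP (p \in _)) => /=; last by rewrite mulr0.
  rewrite inE => -[n _ Fp].
  apply: le_trans (@nneseries_lim_ge _ _ xpredT _ n.+1 _); last first.
    by move=> k _ _; rewrite lee_fin mulr_ge0.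
  rewrite big_nat_recr//= [in leRHS]indicE mem_set//= leeDr//.
  by apply: sume_ge0 => k _; rewrite lee_fin mulr_ge0.
pose mo : {outer_measure set (R * R) -> \bar R} := HB.pack_for
  {outer_measure set (R * R) -> \bar R} mu
  (isOuterMeasure.Build R _ mu mu0 mu_ge0 le_mu mu_sub).
have cara : forall A, measurable A -> mo.-caratheodory A.
  have caraH H : splits H -> mo.-caratheodory H.
    move=> sH; apply: le_caratheodory_measurable => X.
    have phiX p : 0 <= phi p * \1_X p by rewrite mulr_ge0.
    apply: le_trans (splits_upint phiX sH); rewrite /mo /= /mu.
    have e K : upint (fun p => phi p * \1_(X `&` K) p) =
               upint (fun p => phi p * \1_X p * \1_K p).
      by apply: eq_upint => p _; rewrite indicI /= mulrA.
    by rewrite !e.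
  (* Open rays generate the Borel sets of the line, and Caratheodory sets form a sigma-algebra. *)
  have sa (pr : R * R -> R) : (forall a, splits [set p | a < pr p]) ->
      forall B, measurable B -> mo.-caratheodory (pr @^-1` B).
    move=> spr B mB.
    have {mB} : (@RGenOInfty.G R).-sigma.-measurable B.
      by rewrite -RGenOInfty.measurableE.
    move: B.
    apply: (@smallest_sub _ _ _ [set B | mo.-caratheodory (pr @^-1` B)]).
      split=> [|C mC|F mF] /=.
      - by rewrite preimage_set0; exact: (caratheodory_measurable_set0 mo).
      - by rewrite setTD preimage_setC; exact: (@caratheodory_measurable_setC _ _ mo).
      - by rewrite preimage_bigcup; exact: (@caratheodory_measurable_bigcup _ _ mo).
    move=> _ [a ->] /=; apply: caraH.
    by rewrite (_ : _ @^-1` _ = [set p | a < pr p])//; apply/seteqP; split=> p /=;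
      rewrite in_itv/= andbT.
  move=> A; apply: smallest_sub A.
    split=> [|C mC|F mF].
    - exact: (caratheodory_measurable_set0 mo).
    - by rewrite setTD; exact: (@caratheodory_measurable_setC _ _ mo).
    - exact: (@caratheodory_measurable_bigcup _ _ mo).
  by move=> A /= [] [B mB <-]; rewrite setTI; exact: sa.
have mu_sigma : semi_sigma_additive (mu : set (R * R) -> \bar R).
  move=> F mF tF mUF.
  apply: (@caratheodory_measure_sigma_additive _ _ mo F) => //; first by move=> i; exact: cara.
  exact: cara.
pose m : {measure set (R * R) -> \bar R} := HB.pack_for
  {measure set (R * R) -> \bar R} mu
  (isMeasure.Build _ (R * R)%type R mu mu0 mu_ge0 mu_sigma).
by exists m.
Qed.

Hypothesis scale_index : forall c i, 0 <= c ->
  exists2 j, (forall p, fn j p = c * fn i p) & cost j = c * cost i.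

(** Scaling covers by [c] gives one inequality, scaling by its inverse the other. *)
Lemma upintZ c phi : 0 <= c -> upint (fun p => c * phi p) = (c%:E * upint phi)%E.
Proof.
have le a psi : 0 < a -> (upint (fun p => (a * psi p)%R) <= a%:E * upint psi)%E.
  move=> a0; rewrite -lee_pdivrMl//; apply: le_ereal_inf_tmp => _ [s cs <-].
  rewrite lee_pdivrMl//.
  have [t Pt] := choice (fun k => let: ex_intro2 j Hj Kj := scale_index (s k) (ltW a0)
                                  in ex_intro _ j (conj Hj Kj)).
  apply: le_trans (upint_le_cover (_ : covers _ t)) _ => [p Sp|].
    under eq_eseriesr do rewrite (Pt _).1 EFinM.
    rewrite nneseriesZl; last by move=> k _; rewrite lee_fin.
    by rewrite EFinM lee_pmul2l//; exact: cs.
  under eq_eseriesr do rewrite (Pt _).2 EFinM.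
  by rewrite nneseriesZl// => k _; rewrite lee_fin.
rewrite le_eqVlt => /predU1P[<-|c0].
  by rewrite mul0e; apply: upint_eq0 => p _; rewrite mul0r.
apply/le_anti; rewrite le//= -lee_pdivlMl//.
apply: le_trans (le_upint (psi := fun p => c^-1 * (c * phi p)) _) _.
  by move=> p _; rewrite mulKf// gt_eqF.
by apply: le; rewrite invr_gt0.
Qed.

(** * Identification of the integral with the upper integral *)

Section integral.
Variable m : {measure set (R * R) -> \bar R}.
Hypothesis mE : forall A, measurable A -> m A = upint \1_A.

Import HBNNSimple.

(* Compare [m] with the measure [mh] attached to [h] itself: on a level set of
   [h] they differ by the value of [h]. *)
Lemma sintegral_upint (h : {nnsfun (R * R)%type >-> R}) : sintegral m h = upint h.
Proof.
have [mh mhE] := upint_measure (@fun_ge0 _ _ h).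
have mset x : measurable (h @^-1` [set x]) by exact: measurable_sfunP.
rewrite (_ : upint h = mh setT); last first.
  by rewrite mhE; apply: eq_upint => p _; rewrite indicT /= mulr1.
have -> : setT = \bigcup_(x in range h) (h @^-1` [set x]).
  by apply/esym; rewrite -subTset => p _; exists (h p).
rewrite measure_fin_bigcup//; last exact: trivIset_preimage1.
rewrite sintegralE; apply: eq_fsbigr => x; rewrite inE => -[p _ <-].
rewrite [RHS]mhE mE// -upintZ; last exact: fun_ge0.
apply: eq_upint => q _; rewrite indicE; case: (boolP (q \in _)) => [|_].
  by rewrite inE => /= ->.
by rewrite !mulr0.
Qed.

(** Simple functions [g n] increasing to [phi] bound the integral by [upint phi]. Conversely, for
    [t > 1] the sets where [phi <= t * g n] exhaust the plane, so continuity from below of the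
    measure attached to [phi] gives [upint phi] at most [t] times the integral; then [t] tends to
    1. *)
Lemma integral_upint phi : (forall p, 0 <= phi p) ->
  measurable_fun setT phi -> (\int[m]_p (phi p)%:E)%E = upint phi.
Proof.
move=> phi0 mphi.
have mphiE : measurable_fun setT (EFin \o phi) by exact/measurable_EFinP.
pose g := nnsfun_approx measurableT mphiE.
have ndg p : nondecreasing_seq (g ^~ p).
  by move=> i j ij; apply/lefP; exact: nd_nnsfun_approx.
have cg p : EFin \o g ^~ p @ \oo --> (phi p)%:E.
  by apply: (cvg_nnsfun_approx measurableT mphiE) => // q _; rewrite lee_fin.
have g_le n p : g n p <= phi p.
  rewrite -lee_fin; apply: cvge_ge (cg p); near=> k.
  by rewrite /= lee_fin; apply: ndg; near: k; exact: nbhs_infty_ge.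
have ephi0 p : (0 <= (EFin \o phi) p)%E by rewrite /= lee_fin.
have limE : (\int[m]_p (phi p)%:E)%E = limn (sintegral m \o g).
  exact: (nd_ge0_integral_lim m ephi0 ndg cg).
have cvgS : cvgn (sintegral m \o g) by exact: is_cvg_sintegral ndg.
have sle n : (sintegral m (g n) <= \int[m]_p (phi p)%:E)%E.
  rewrite limE; apply: lime_ge => //; near=> k; rewrite /=.
  by apply: le_sintegral => p; apply: ndg; near: k; exact: nbhs_infty_ge.
apply/le_anti/andP; split.
  rewrite limE; apply: lime_le => //; apply: nearW => n /=.
  by rewrite sintegral_upint; apply: le_upint => p _; exact: g_le.
have [mphi' mphiE'] := upint_measure phi0.
have le_t t : 1 < t -> (upint phi <= t%:E * \int[m]_p (phi p)%:E)%E.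
  move=> t1; pose B n := [set p | phi p <= t * g n p].
  have mB n : measurable (B n).
    rewrite -[B n]setTI; apply: measurable_fun_le => //.
    by apply: measurable_funM => //; exact: measurable_cst.
  have UB : \bigcup_n B n = setT.
    rewrite -subTset => p _; have := phi0 p; rewrite le_eqVlt => /predU1P[p0|p0].
      exists 0%N => //; rewrite /B /= -p0 mulr_ge0// ?(ltW (lt_trans _ t1))//.
    have : \forall n \near \oo, phi p / t < g n p.
      have /fine_cvgP[_ /= cgp] := cg p.
      apply: (cvgr_gt _ cgp); rewrite ltr_pdivrMr ?(lt_trans _ t1)//.
      by rewrite ltr_pMr.
    case=> N _ /(_ N (leqnn N)) /= gN; exists N => //.
      rewrite /B /= mulrC -ler_pdivrMr ?(lt_trans _ t1)//.
    exact: ltW.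
  have -> : upint phi = mphi' setT.
    by rewrite mphiE'; apply: eq_upint => p _; rewrite indicT /= mulr1.
  have := @nondecreasing_cvg_mu _ _ _ mphi' B mB.
  rewrite UB => /(_ measurableT) => cB.
  have {}cB : mphi' \o B @ \oo --> mphi' setT.
    apply: cB => i j ij; apply/subsetPset => p; rewrite /B /= => /le_trans; apply.
    by rewrite ler_wpM2l ?(ltW (lt_trans _ t1))//; exact: ndg.
  apply: cvge_le cB.
  apply: nearW => n; rewrite /= mphiE'.
  apply: le_trans (le_upint (psi := fun p => t * g n p) _) _.
    move=> p _; rewrite indicE; case: (boolP (p \in B n)); rewrite ?mulr1 ?mulr0.
      by rewrite inE.
    by rewrite mulr_ge0 ?(ltW (lt_trans _ t1)).
  rewrite upintZ ?(ltW (lt_trans _ t1))// lee_pmul2l ?lte_fin ?(lt_trans _ t1)//.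
  by rewrite -sintegral_upint.
have : (0 <= \int[m]_p (phi p)%:E)%E by apply: integral_ge0 => p _; rewrite lee_fin.
move: le_t; case: (\int[m]_p (phi p)%:E)%E => [x le_t x0|_ _|_ //]; last exact: leey.
apply/lee_addgt0Pr => e e0.
rewrite lee_fin in x0; have x1 : 0 < x + 1 by lra.
(* For an integral [x] this factor adds [e * x / (x + 1)], which is at most [e]; the [+ 1] covers
   [x = 0]. *)
apply: le_trans (le_t (1 + e / (x + 1)) _) _; first by rewrite ltrDl divr_gt0.
rewrite -EFinM -EFinD lee_fin mulrDl mul1r lerD2l mulrAC ler_pdivrMr// ler_pM2l//.
by lra.
Unshelve. all: by end_near. Qed.

End integral.

End upper_integral.

(** * Clamping to an interval *)

Definition clamp {R : realType} (a b x : R) : R := Num.max a (Num.min x b).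

Definition vol {R : realType} (C : R * R -> R) (a b c d : R) : R :=
  C (b, d) - C (b, c) - C (a, d) + C (a, c).

Section clamp.
Context {R : realType}.
Implicit Types a b x y : R.

Lemma clamp_itv a b x : a <= b -> a <= clamp a b x <= b.
Proof. by move=> ab; rewrite /clamp le_max lexx /= ge_max ab ge_min lexx orbT. Qed.

Lemma clamp_id a b x : a <= x <= b -> clamp a b x = x.
Proof. by move=> /andP[ax xb]; rewrite /clamp min_l// max_r. Qed.

Lemma clamp_le a b x : x <= a -> a <= b -> clamp a b x = a.
Proof. by move=> xa ab; rewrite /clamp max_l// ge_min xa. Qed.

Lemma clamp_ge a b x : b <= x -> a <= b -> clamp a b x = b.
Proof. by move=> bx ab; rewrite /clamp min_r// max_r. Qed.

Lemma le_clamp a b x y : x <= y -> clamp a b x <= clamp a b y.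
Proof.
move=> xy; rewrite /clamp ge_max le_max lexx /= le_max.
by rewrite le_min !ge_min xy lexx !orbT.
Qed.

Lemma clamp_lip a b x y : x <= y -> clamp a b y - clamp a b x <= y - x.
Proof.
rewrite /clamp => xy; case: (leP x b) => ?; case: (leP y b) => ?; try lra.
all: case: (leP a) => ?; try lra; case: (leP a) => ?; lra.
Qed.

(** At least one of the two clamped points on the right is [m], and its value cancels. This makes
    clamped volumes additive under bisection. *)
Lemma clamp_split (f : R -> R) a m b x : a <= m <= b ->
  f (clamp a b x) = f (clamp a m x) + f (clamp m b x) - f m.
Proof.
move=> /andP[am mb]; have ab := le_trans am mb.
have [xm|/ltW mx] := leP x m.
  rewrite (clamp_le xm mb) addrK; congr f.
  by rewrite /clamp !min_l// (le_trans xm).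
rewrite (clamp_ge mx am) addrAC subrr add0r; congr f.
rewrite /clamp; case: (leP x b) => xb; rewrite !max_r//; exact: le_trans am mx.
Qed.

(** If [[x, y]] misses or merely touches [[a, b]], both points clamp to the same end; otherwise
    clamping moves [x] up and [y] down. Monotonicity is asked only on the hull, because copulas
    vanish off the unit square. *)
Lemma clamp_sub (f : R -> R) a b x y : a <= b -> x <= y ->
  {in `[Num.min a x, Num.max b y] &, {homo f : s t / s <= t}} ->
  f (clamp a b y) - f (clamp a b x) <= f y - f x.
Proof.
move=> ab xy hf.
have hf' s t : Num.min a x <= s -> s <= t -> t <= Num.max b y -> f s <= f t.
  by move=> ms st tM; apply: hf => //; rewrite in_itv /= ?ms ?tM ?(le_trans st) ?(le_trans ms).
have fxy : f x <= f y by apply: hf' => //; rewrite ?ge_min ?le_max lexx orbT.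
have [ya|ay] := leP y a.
  by rewrite !clamp_le// ?(le_trans xy)// subrr subr_ge0.
have [bx|xb] := leP b x.
  by rewrite !clamp_ge// ?(le_trans _ xy)// subrr subr_ge0.
apply: lerB; apply: hf' => //.
- have /andP[+ _] := clamp_itv y ab; apply: le_trans; by rewrite ge_min lexx.
- by rewrite /clamp ge_max (ltW ay) ge_min lexx.
- by rewrite le_max lexx orbT.
- by rewrite ge_min lexx orbT.
- by rewrite /clamp le_max le_min lexx (ltW xb) orbT.
- by have /andP[_ H] := clamp_itv x ab; rewrite le_max H.
Qed.

End clamp.

(** * Monotonicity, Lipschitz bounds and extremal copulas *)

Section copula_theory.
Context {R : realType}.
Implicit Types (C D E : copula R) (a b c d u v : R).

Lemma cop_2inc C a b c d : 0 <= a -> a <= b -> b <= 1 -> 0 <= c -> c <= d -> d <= 1 ->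
  0 <= vol C a b c d.
Proof. exact: (copula_2increasing (copulaP C)). Qed.

Lemma cop_u0 C u : 0 <= u <= 1 -> C (u, 0) = 0.
Proof. by move=> /(copula_grounded (copulaP C)) []. Qed.

Lemma cop_0v C v : 0 <= v <= 1 -> C (0, v) = 0.
Proof. by move=> /(copula_grounded (copulaP C)) []. Qed.

Lemma cop_u1 C u : 0 <= u <= 1 -> C (u, 1) = u.
Proof. by move=> /(copula_margins (copulaP C)) []. Qed.

Lemma cop_1v C v : 0 <= v <= 1 -> C (1, v) = v.
Proof. by move=> /(copula_margins (copulaP C)) []. Qed.

Definition copE := (@cop_u0, @cop_0v, @cop_u1, @cop_1v).

Lemma cop_off C p : ~ unit_square p -> C p = 0.
Proof. exact: copula_off (copulaP C) p. Qed.

(** The lower bound is the volume of the rectangle below height [v], the upper bound comes from the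
    one above it. *)
Lemma cop_incr1 C a b v : 0 <= a -> a <= b -> b <= 1 -> 0 <= v <= 1 ->
  0 <= C (b, v) - C (a, v) <= b - a.
Proof.
move=> a0 ab b1 v01; have /andP[v0 v1] := v01.
have := cop_2inc C a0 ab b1 v0 v1 (lexx 1).
have := cop_2inc C a0 ab b1 (lexx 0) v0 v1.
by rewrite /vol !copE//; lra.
Qed.

Lemma cop_incr2 C u c d : 0 <= c -> c <= d -> d <= 1 -> 0 <= u <= 1 ->
  0 <= C (u, d) - C (u, c) <= d - c.
Proof.
move=> c0 cd d1 u01; have /andP[u0 u1] := u01.
have := cop_2inc C u0 u1 (lexx 1) c0 cd d1.
have := cop_2inc C (lexx 0) u0 u1 c0 cd d1.
by rewrite /vol !copE//; lra.
Qed.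

Lemma cop_lip1 C a b v : 0 <= a <= 1 -> 0 <= b <= 1 -> 0 <= v <= 1 ->
  `|C (b, v) - C (a, v)| <= `|b - a|.
Proof.
move=> /andP[a0 a1] /andP[b0 b1] v01; have [ab|/ltW ba] := leP a b.
  by have /andP[? ?] := cop_incr1 C a0 ab b1 v01; rewrite !ger0_norm//; lra.
by have /andP[? ?] := cop_incr1 C b0 ba a1 v01; rewrite distrC (distrC b) !ger0_norm//; lra.
Qed.

Lemma cop_lip2 C u c d : 0 <= c <= 1 -> 0 <= d <= 1 -> 0 <= u <= 1 ->
  `|C (u, d) - C (u, c)| <= `|d - c|.
Proof.
move=> /andP[c0 c1] /andP[d0 d1] u01; have [cd|/ltW dc] := leP c d.
  by have /andP[? ?] := cop_incr2 C c0 cd d1 u01; rewrite !ger0_norm//; lra.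
by have /andP[? ?] := cop_incr2 C d0 dc c1 u01; rewrite distrC (distrC d) !ger0_norm//; lra.
Qed.

Lemma cop_lip C a b c d : 0 <= a <= 1 -> 0 <= b <= 1 -> 0 <= c <= 1 -> 0 <= d <= 1 ->
  `|C (b, d) - C (a, c)| <= `|b - a| + `|d - c|.
Proof.
move=> a01 b01 c01 d01; rewrite -(subrK (C (a, d)) (C (b, d))) -addrA.
by apply: le_trans (ler_normD _ _) (lerD _ _); [exact: cop_lip1|exact: cop_lip2].
Qed.

Lemma cop_ge0 C p : 0 <= C p.
Proof.
have [[u01 v01]|/cop_off-> //] := pselect (unit_square p); case: p u01 v01 => u v /= u01.
move=> /andP[v0 v1]; have /andP[] := cop_incr2 C (lexx 0) v0 v1 u01.
by rewrite (cop_u0 C u01) subr0.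
Qed.

Lemma cop_leM C : cop_le C cop_M.
Proof.
move=> [u v] [/= u01 v01]; rewrite on_squareE//= le_min.
have /andP[u0 u1] := u01; have /andP[v0 v1] := v01.
have /andP[_] := cop_incr2 C (lexx 0) v0 v1 u01.
have /andP[_] := cop_incr1 C (lexx 0) u0 u1 v01.
by rewrite !copE// !subr0 => -> ->.
Qed.

Lemma cop_geW C : cop_le cop_W C.
Proof.
move=> [u v] [/= u01 v01]; rewrite on_squareE//= ge_max cop_ge0 andbT.
have /andP[u0 u1] := u01; have /andP[v0 v1] := v01.
have /andP[_] := cop_incr2 C v0 v1 (lexx 1) u01.
by rewrite !copE//; lra.
Qed.

End copula_theory.
(** * The measure of a copula *)
Section copula_volume.
Context {R : realType}.
Variable C : copula R.
Implicit Types (a b c d : R).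

Lemma volDu a m b c d : vol C a b c d = vol C a m c d + vol C m b c d.
Proof. by rewrite /vol; lra. Qed.

Lemma volDv a b c m d : vol C a b c d = vol C a b c m + vol C a b m d.
Proof. by rewrite /vol; lra. Qed.

(** Degenerate sides are allowed, so that [rectI] can represent an empty intersection. *)
Record rect := Rect {
  r_a : R ; r_b : R ; r_c : R ; r_d : R ;
  rectP1 : [/\ 0 <= r_a, r_a <= r_b & r_b <= 1] ;
  rectP2 : [/\ 0 <= r_c, r_c <= r_d & r_d <= 1] }.
Implicit Types (q r s : rect).

Definition rvol r := vol C (r_a r) (r_b r) (r_c r) (r_d r).

Lemma rvol_ge0 r : 0 <= rvol r.
Proof. by case: r => a b c d [? ? ?] [? ? ?]; exact: cop_2inc. Qed.

Lemma rectI_subproof a b x y : [/\ 0 <= a, a <= b & b <= 1] -> x <= y ->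
  [/\ 0 <= clamp a b x, clamp a b x <= clamp a b y & clamp a b y <= 1].
Proof.
move=> [a0 ab b1] xy; have /andP[? _] := clamp_itv x ab.
have /andP[_ ?] := clamp_itv y ab; rewrite le_clamp//; split => //; lra.
Qed.

(** The sides of [r] are clamped to those of [q]: this is the intersection when the two overlap, and
    a rectangle of volume 0 otherwise. *)
Definition rectI q r := Rect
  (rectI_subproof (rectP1 q) (let: And3 _ h _ := rectP1 r in h))
  (rectI_subproof (rectP2 q) (let: And3 _ h _ := rectP2 r in h)).

Lemma vol_incr1 c d : 0 <= c -> c <= d -> d <= 1 ->
  {in `[0, 1] &, {homo (fun u => C (u, d) - C (u, c)) : s t / s <= t}}.
Proof.
move=> c0 cd d1 s t /itvP s01 /itvP t01 st.
by have := @cop_2inc _ C s t c d; rewrite /vol !s01 !t01 => /(_ isT); lra.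
Qed.

Lemma vol_incr2 a b : 0 <= a -> a <= b -> b <= 1 ->
  {in `[0, 1] &, {homo (fun v => C (b, v) - C (a, v)) : s t / s <= t}}.
Proof.
move=> a0 ab b1 s t /itvP s01 /itvP t01 st.
by have := @cop_2inc _ C a b s t; rewrite /vol !s01 !t01 => /(_ a0 ab b1 isT st isT); lra.
Qed.

(** One coordinate at a time: [clamp_sub] is applied to increments in [u] over the clamped second
    side, then to increments in [v] over the full first side of [r]. *)
Lemma rvolI_le q r : rvol (rectI q r) <= rvol r.
Proof.
have sub x y z t (f : R -> R) : 0 <= x -> 0 <= y -> z <= 1 -> t <= 1 ->
    {in `[0, 1] &, {homo f : s t / s <= t}} ->
    {in `[Num.min x y, Num.max z t] &, {homo f : s t / s <= t}}.
  move=> x0 y0 z1 t1 hf s s'; rewrite !in_itv /= => /andP[h1 h2] /andP[h3 h4].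
  have m0 : 0 <= Num.min x y by rewrite le_min x0.
  have M1 : Num.max z t <= 1 by rewrite ge_max z1.
  by apply: hf; rewrite in_itv /=; lra.
have [_ cd d1] := rectP2 (rectI q r); have [c0 _ _] := rectP2 (rectI q r).
case: q r c0 cd d1 => a b c d P1 P2 [a' b' c' d' P1' P2']; rewrite /rvol /=.
set x := clamp c d c'; set y := clamp c d d' => x0 xy y1.
have [a0 ab b1] := P1; have [a0' ab' b1'] := P1'.
have [c0 cd d1] := P2; have [c0' cd' d1'] := P2'.
have := clamp_sub ab ab' (sub _ _ _ _ _ a0 a0' b1 b1' (vol_incr1 x0 xy y1)).
have := clamp_sub cd cd' (sub _ _ _ _ _ c0 c0' d1 d1' (vol_incr2 a0' ab' b1')).
by rewrite /= -/x -/y /vol; lra.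
Qed.

(** Only the parts of the [s k] inside [q] are counted, so the property passes from the two halves
    of [q] to [q]. *)
Definition covered (s : nat -> rect) q :=
  ((rvol q)%:E <= \sum_(k <oo) (rvol (rectI q (s k)))%:E)%E.

Lemma coveredD (s : nat -> rect) q q1 q2 : rvol q = rvol q1 + rvol q2 ->
  (forall r, rvol (rectI q r) = rvol (rectI q1 r) + rvol (rectI q2 r)) ->
  covered s q1 -> covered s q2 -> covered s q.
Proof.
rewrite /covered => -> e c1 c2; under eq_eseriesr do rewrite e EFinD.
rewrite EFinD nneseriesD; first exact: leeD.
all: by move=> k _ _; rewrite lee_fin rvol_ge0.
Qed.

Lemma bisect_u (s : nat -> rect) q : ~ covered s q -> exists q',
  [/\ ~ covered s q', r_c q' = r_c q /\ r_d q' = r_d q,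
     r_a q <= r_a q', r_b q' <= r_b q & r_b q' - r_a q' = (r_b q - r_a q) / 2].
Proof.
case: q => a b c d [a0 ab b1] P2 nc; pose m := (a + b) / 2.
have P11 : [/\ 0 <= a, a <= m & m <= 1] by rewrite /m; split; lra.
have P12 : [/\ 0 <= m, m <= b & b <= 1] by rewrite /m; split; lra.
pose q1 := Rect P11 P2; pose q2 := Rect P12 P2.
have [c1|nc1] := pselect (covered s q1); last first.
  by exists q1; split => //=; rewrite /m; lra.
have [c2|nc2] := pselect (covered s q2); last first.
  by exists q2; split => //=; rewrite /m; lra.
exfalso; apply: nc; apply: (coveredD _ _ c1 c2); first exact: volDu.
move=> r; rewrite /rvol /= /vol.
set x := clamp c d _; set y := clamp c d _.
have amb : a <= m <= b by rewrite /m; lra.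
have := clamp_split (fun u => C (u, y) - C (u, x)) (r_a r) amb.
have := clamp_split (fun u => C (u, y) - C (u, x)) (r_b r) amb.
by rewrite /=; lra.
Qed.

Lemma bisect_v (s : nat -> rect) q : ~ covered s q -> exists q',
  [/\ ~ covered s q', r_a q' = r_a q /\ r_b q' = r_b q,
     r_c q <= r_c q', r_d q' <= r_d q & r_d q' - r_c q' = (r_d q - r_c q) / 2].
Proof.
case: q => a b c d P1 [c0 cd d1] nc; pose m := (c + d) / 2.
have P21 : [/\ 0 <= c, c <= m & m <= 1] by rewrite /m; split; lra.
have P22 : [/\ 0 <= m, m <= d & d <= 1] by rewrite /m; split; lra.
pose q1 := Rect P1 P21; pose q2 := Rect P1 P22.
have [c1|nc1] := pselect (covered s q1); last first.
  by exists q1; split => //=; rewrite /m; lra.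
have [c2|nc2] := pselect (covered s q2); last first.
  by exists q2; split => //=; rewrite /m; lra.
exfalso; apply: nc; apply: (coveredD _ _ c1 c2); first exact: volDv.
move=> r; rewrite /rvol /= /vol.
set x := clamp a b _; set y := clamp a b _.
have cmd : c <= m <= d by rewrite /m; lra.
have := clamp_split (fun v => C (y, v) - C (x, v)) (r_c r) cmd.
have := clamp_split (fun v => C (y, v) - C (x, v)) (r_d r) cmd.
by rewrite /=; lra.
Qed.

Lemma nested_itv (a b : nat -> R) :
  (forall n, [/\ a n <= a n.+1, b n.+1 <= b n & a n <= b n]) ->
  exists x, forall n, a n <= x <= b n.
Proof.
move=> ab; have homo_a : {homo a : m n / (m <= n)%N >-> m <= n}.
  by apply: homo_leq => [//|? ? ?|n]; [exact: le_trans|have [] := ab n].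
have homo_b : {homo b : m n / (m <= n)%N >-> n <= m}.
  by apply: homo_leq => [//|? ? ? h1 h2|n]; [exact: le_trans h2 h1|have [] := ab n].
have le_ab m n : a m <= b n.
  have [_ _ h] := ab (maxn m n).
  by rewrite (le_trans (homo_a _ _ (leq_maxl m n)))// (le_trans h)// homo_b// leq_maxr.
exists (sup (range a)) => n; apply/andP; split.
  by apply: ub_le_sup; [exists (b 0%N) => _ [m _ <-]|exists n].
by apply: ge_sup => [|_ [m _ <-]//]; exists (a 0%N); exists 0%N.
Qed.

(* If q were not covered, repeated bisection would give arbitrarily small
   uncovered rectangles around some point x; but they are eventually contained
   in a single s k, hence covered. *)
Lemma covered_nbhs (s : nat -> rect) q :
  (forall x y, r_a q <= x <= r_b q -> r_c q <= y <= r_d q ->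
    exists k, [/\ r_a (s k) < x, x < r_b (s k) \/ r_b q <= r_b (s k),
                  r_c (s k) < y & y < r_d (s k) \/ r_d q <= r_d (s k)]) ->
  covered s q.
Proof.
move=> cov; apply: contrapT => nc.
pose X := {q' | ~ covered s q'}.
pose D (q1 q2 : X) := let r := sval q1 in let r' := sval q2 in
  [/\ r_a r <= r_a r', r_b r' <= r_b r, r_c r <= r_c r' & r_d r' <= r_d r] /\
  (r_b r' - r_a r' = (r_b r - r_a r) / 2 /\ r_d r' - r_c r' = (r_d r - r_c r) / 2).
have [f [f0 Df]] : {f : nat -> X | f 0%N = exist _ q nc /\ forall n, D (f n) (f n.+1)}.
  apply: dependent_choice => -[r nr]; apply/cid.
  have [r1 [nr1 [e1 e2] ? ? ?]] := bisect_u nr.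
  have [r2 [nr2 [e3 e4] ? ? ?]] := bisect_v nr1.
  by exists (exist _ r2 nr2); rewrite /D /= -e1 -e2 e3 e4.
pose g n := sval (f n).
have lenu n : r_b (g n) - r_a (g n) = (r_b q - r_a q) / 2 ^+ n.
  elim: n => [|n IH]; first by rewrite /g f0 /= divr1.
  by have [_ [-> _]] := Df n; rewrite -/(g n) IH exprSr invfM mulrA.
have lenv n : r_d (g n) - r_c (g n) = (r_d q - r_c q) / 2 ^+ n.
  elim: n => [|n IH]; first by rewrite /g f0 /= divr1.
  by have [_ [_ ->]] := Df n; rewrite -/(g n) IH exprSr invfM mulrA.
have [x xP] : exists x, forall n, r_a (g n) <= x <= r_b (g n).
  by apply: nested_itv => n; have [[? ? _ _] _] := Df n; have [] := rectP1 (g n).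
have [y yP] : exists y, forall n, r_c (g n) <= y <= r_d (g n).
  by apply: nested_itv => n; have [[_ _ ? ?] _] := Df n; have [] := rectP2 (g n).
have gq n : [/\ r_b (g n) <= r_b q & r_d (g n) <= r_d q].
  elim: n => [|n [h1 h2]]; first by rewrite /g f0.
  by have [[_ k1 _ k2] _] := Df n; split; [exact: le_trans k1 h1|exact: le_trans k2 h2].
have := xP 0%N; have := yP 0%N; rewrite /g f0 /= => y0 x0.
have [k [ax xb cy yd]] := cov _ _ x0 y0.
have small e l : 0 < e -> \forall n \near \oo, l / 2 ^+ n < e :> R.
  move=> e0; have : l / 2 ^+ n @[n --> \oo] --> (0 : R).
    rewrite -(mulr0 l); apply: cvgMr.
    by under eq_fun do rewrite -exprVn; apply: cvg_expr; rewrite ger0_norm; lra.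
  by move=> h; apply: (cvgr_lt _ h).
(* A right or upper side of [s k] either lies strictly beyond the limit point or already reaches the
   edge of [q]. *)
have near1 (z e t : R) (l : R) : z < e \/ t <= e ->
    \forall n \near \oo, forall w, w <= t -> w - z <= l / 2 ^+ n -> w <= e.
  move=> [ze|te]; last by near=> n => w wt _; exact: le_trans wt te.
  have := small (e - z) l; rewrite subr_gt0 => /(_ ze) h.
  near=> n => w wt wz; have : l / 2 ^+ n < e - z by near: n; exact: h.
  by lra.
have [n Hn] : exists n, [/\ r_a (s k) <= r_a (g n), r_b (g n) <= r_b (s k),
    r_c (s k) <= r_c (g n) & r_d (g n) <= r_d (s k)].
  near \oo => n; exists n; split.
  - have : (r_b q - r_a q) / 2 ^+ n < x - r_a (s k) by near: n; apply: small; rewrite subr_gt0.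
    by rewrite -lenu; have := xP n; lra.
  - have [h _] := gq n; have := xP n; have := lenu n => l1 l2.
    have : forall w, w <= r_b q -> w - x <= (r_b q - r_a q) / 2 ^+ n -> w <= r_b (s k).
      by near: n; exact: near1.
    by apply => //; rewrite -l1; lra.
  - have : (r_d q - r_c q) / 2 ^+ n < y - r_c (s k) by near: n; apply: small; rewrite subr_gt0.
    by rewrite -lenv; have := yP n; lra.
  - have [_ h] := gq n; have := yP n; have := lenv n => l1 l2.
    have : forall w, w <= r_d q -> w - y <= (r_d q - r_c q) / 2 ^+ n -> w <= r_d (s k).
      by near: n; exact: near1.
    by apply => //; rewrite -l1; lra.
apply: (svalP (f n)); rewrite -/(g n) /covered.
have [? ? ? ?] := Hn; have [_ ? _] := rectP1 (g n); have [_ ? _] := rectP2 (g n).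
apply: le_trans (@nneseries_lim_ge _ _ xpredT _ k.+1 _); last first.
  by move=> i _; rewrite lee_fin rvol_ge0.
rewrite big_nat_recr//= [X in (_ <= _ + X)%E](_ : _ = (rvol (g n))%:E).
  by rewrite leeDr// sume_ge0// => i _; rewrite lee_fin rvol_ge0.
rewrite {1}/rvol /= (clamp_le (x := r_a _))// (clamp_ge (x := r_b _))//.
by rewrite (clamp_le (x := r_c _))// (clamp_ge (x := r_d _)).
Unshelve. all: by end_near. Qed.

End copula_volume.

Arguments rect R : clear implicits.

(** * Existence and uniqueness of [mu_ C] *)

Section copula_measure.
Context {R : realType}.
Variable C : copula R.

Definition rect_set (r : rect R) : set (R * R) := `]r_a r, r_b r] `*` `]r_c r, r_d r].

(** The left and lower edges, which half-open rectangles cannot reach, have no mass because copulas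
    are grounded. *)
Definition left_open_square : set (R * R) := `]0, 1] `*` `]0, 1].

Let zero_rect : exists2 r : rect R, (forall p, \1_(rect_set r) p = 0 :> R) & rvol C r = 0.
Proof.
have P : [/\ 0 <= 0 :> R, 0 <= 0 :> R & 0 <= 1 :> R] by [].
exists (Rect P P); last by rewrite /rvol /vol /=; lra.
move=> p; rewrite indicE memNset// => -[/=]; rewrite in_itv /= => /andP[h1 h2].
by have := lt_le_trans h1 h2; rewrite ltxx.
Qed.

Let indic_rect_ge0 (r : rect R) p : 0 <= \1_(rect_set r) p :> R.
Proof. by []. Qed.

Definition cop_upint := upint (fun r => \1_(rect_set r)) (rvol C) left_open_square.

Let splits_rect (H : set (R * R)) :
  (forall r, exists r1 r2 : rect R, [/\ rect_set r `&` H `<=` rect_set r1,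
    rect_set r `&` ~` H `<=` rect_set r2 & rvol C r = rvol C r1 + rvol C r2]) ->
  splits (fun r => \1_(rect_set r)) (rvol C) left_open_square H.
Proof.
move=> ex r; have [r1 [r2 [s1 s2 ->]]] := ex r; rewrite EFinD.
have le (A : set (R * R)) r' : rect_set r `&` A `<=` rect_set r' ->
    (cop_upint (fun p => (\1_(rect_set r) p * \1_A p)%R) <= (rvol C r')%:E)%E.
  move=> sub; apply: (upint_fn_le indic_rect_ge0 (rvol_ge0 C) zero_rect) => //=.
  move=> p _; rewrite -[_ * _]/((\1_(rect_set r) \* \1_A) p) -indicI !indicE ler_nat.
  by case: (boolP (p \in _ `&` _)) => //; rewrite inE => /sub pr; rewrite mem_set.
by apply: leeD; exact: le.
Qed.

Let splits_fst a : splits (fun r => \1_(rect_set r)) (rvol C) left_open_square [set p | a < p.1].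
Proof.
apply: splits_rect => -[ra rb rc rd [a0 ab b1] P2]; pose x := clamp ra rb a.
have /andP[ax xb] := clamp_itv a ab.
have P11 : [/\ 0 <= x, x <= rb & rb <= 1] by split => //; exact: le_trans ax.
have P12 : [/\ 0 <= ra, ra <= x & x <= 1] by split => //; exact: le_trans xb b1.
exists (Rect P11 P2), (Rect P12 P2); split; last by rewrite addrC; exact: volDu.
  move=> [p q] [[/= + qI] ap]; rewrite !in_itv /= => /andP[h1 h2].
  by split => //=; rewrite in_itv /= h2 andbT /x /clamp gt_max h1 gt_min ap.
move=> [p q] [[/= + qI] /negP]; rewrite !in_itv /= -leNgt => /andP[h1 h2] pa.
by split => //=; rewrite in_itv /= h1 /x /clamp le_max le_min pa h2 orbT.
Qed.

Let splits_snd a : splits (fun r => \1_(rect_set r)) (rvol C) left_open_square [set p | a < p.2].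
Proof.
apply: splits_rect => -[ra rb rc rd P1 [c0 cd d1]]; pose x := clamp rc rd a.
have /andP[cx xd] := clamp_itv a cd.
have P21 : [/\ 0 <= x, x <= rd & rd <= 1] by split => //; exact: le_trans cx.
have P22 : [/\ 0 <= rc, rc <= x & x <= 1] by split => //; exact: le_trans xd d1.
exists (Rect P1 P21), (Rect P1 P22); split; last by rewrite addrC; exact: volDv.
  move=> [p q] [[/= pI +] ap]; rewrite !in_itv /= => /andP[h1 h2].
  by split => //=; rewrite in_itv /= h2 andbT /x /clamp gt_max h1 gt_min ap.
move=> [p q] [[/= pI +] /negP]; rewrite !in_itv /= -leNgt => /andP[h1 h2] pa.
by split => //=; rewrite in_itv /= h1 /x /clamp le_max le_min pa h2 orbT.
Qed.

(** To apply [covered_nbhs], the right and upper sides of [s k] grow by [h k], capped at 1, and the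
    target rectangle is cut off from the axes at [e']. By the Lipschitz bounds this costs at most
    [2 * h k] per rectangle and [2 * e] for the cut, hence [4 * e] in all. *)
Let covers_le (s : nat -> rect R) u v e : 0 < e -> 0 < u <= 1 -> 0 < v <= 1 ->
  `]0, u] `*` `]0, v] `<=` \bigcup_k rect_set (s k) ->
  ((C (u, v))%:E <= \sum_(k <oo) (rvol C (s k))%:E + (4 * e)%:E)%E.
Proof.
move=> e0 /andP[u0 u1] /andP[v0 v1] cov.
pose h k : R := e / (2 ^ k.+1)%:R.
have h0 k : 0 < h k by rewrite divr_gt0// ltr0n expn_gt0.
have P1 k : [/\ 0 <= r_a (s k), r_a (s k) <= Num.min 1 (r_b (s k) + h k) &
    Num.min 1 (r_b (s k) + h k) <= 1].
  have [a0 ab b1] := rectP1 (s k); split => //; last by rewrite ge_min lexx.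
  by rewrite le_min (le_trans ab)//= (le_trans ab)// lerDl ltW.
have P2 k : [/\ 0 <= r_c (s k), r_c (s k) <= Num.min 1 (r_d (s k) + h k) &
    Num.min 1 (r_d (s k) + h k) <= 1].
  have [a0 ab b1] := rectP2 (s k); split => //; last by rewrite ge_min lexx.
  by rewrite le_min (le_trans ab)//= (le_trans ab)// lerDl ltW.
pose s' k := Rect (P1 k) (P2 k).
have s'_le k : rvol C (s' k) <= rvol C (s k) + (h k + h k).
  have [a0 ab b1] := rectP1 (s k); have [c0 cd d1] := rectP2 (s k).
  have [_ _ b1'] := P1 k; have [_ _ d1'] := P2 k.
  have b01 := le_trans a0 ab; have d01 := le_trans c0 cd.
  rewrite /rvol /vol /=; set b' := Num.min 1 _ in b1' *; set d' := Num.min 1 _ in d1' *.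
  have bb' : r_b (s k) <= b' by rewrite le_min b1 lerDl ltW.
  have dd' : r_d (s k) <= d' by rewrite le_min d1 lerDl ltW.
  have b'h : b' <= r_b (s k) + h k by rewrite ge_min lexx orbT.
  have d'h : d' <= r_d (s k) + h k by rewrite ge_min lexx orbT.
  have d'01 : 0 <= d' <= 1 by rewrite d1' (le_trans d01).
  have c01 : 0 <= r_c (s k) <= 1 by rewrite c0 (le_trans cd).
  have b01' : 0 <= r_b (s k) <= 1 by rewrite b01.
  have a01 : 0 <= r_a (s k) <= 1 by rewrite a0 (le_trans ab).
  have /andP[k1 k2] := cop_incr1 C b01 bb' b1' d'01.
  have /andP[k3 k4] := cop_incr1 C b01 bb' b1' c01.
  have /andP[k5 k6] := cop_incr2 C d01 dd' d1' b01'.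
  have /andP[k7 k8] := cop_incr2 C d01 dd' d1' a01.
  lra.
pose e' := Num.min e (Num.min u v).
have e'0 : 0 < e' by rewrite !lt_min e0 u0.
have e'e : e' <= e by rewrite ge_min lexx.
have e'u : e' <= u by rewrite !ge_min lexx orbT.
have e'v : e' <= v by rewrite !ge_min lexx !orbT.
pose q : rect R := Rect (And3 (ltW e'0) e'u u1) (And3 (ltW e'0) e'v v1).
have cq : covered C s' q.
  apply: covered_nbhs => x y /= /andP[ex xu] /andP[ey yv].
  have [k _ [/=]] : (\bigcup_k rect_set (s k)) (x, y).
    by apply: cov; split; rewrite /= in_itv /= ?xu ?yv andbT; apply: (lt_le_trans e'0).
  have min_or (t z w : R) : w <= t -> t <= 1 -> w <= z ->
      w < Num.min 1 (z + h k) \/ t <= Num.min 1 (z + h k).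
    move=> wt t1 wz; have [?|mt] := leP t (Num.min 1 (z + h k)); [by right|left].
    rewrite lt_min; apply/andP; move: mt; case: (leP 1 (z + h k)) => *;
      split; have := h0 k; lra.
  rewrite !in_itv /= => /andP[ax xb] /andP[cy yd].
  by exists k; split => //=; exact: min_or.
have volq : C (u, v) <= rvol C q + (e + e).
  rewrite /rvol /vol /=.
  have u01 : 0 <= u <= 1 by rewrite u1 ltW.
  have v01 : 0 <= v <= 1 by rewrite v1 ltW.
  have e'1 := le_trans e'u u1.
  have e'01 : 0 <= e' <= 1 by rewrite e'1 ltW.
  have := cop_incr1 C (lexx 0) (ltW e'0) e'1 v01.
  have := cop_incr2 C (lexx 0) (ltW e'0) e'1 u01.
  have := cop_ge0 C (e', e'); rewrite !copE//; lra.
apply: (@le_trans _ _ (rvol C q + (e + e))%:E); first by rewrite lee_fin.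
rewrite EFinD (_ : 4 * e = (e + e) + (e + e)); last by ring.
rewrite [((e + e) + _)%:E]EFinD addeA leeD2r//.
apply: le_trans cq _.
apply: (@le_trans _ _ (\sum_(k <oo) ((rvol C (s k))%:E + ((e + e) / (2 ^ k.+1)%:R)%:E))%E).
  apply: lee_nneseries => [k _ _|k _]; first by rewrite lee_fin rvol_ge0.
  rewrite -EFinD lee_fin (le_trans (rvolI_le _ _ _))// (le_trans (s'_le k))//.
  by rewrite /h mulrDl.
by apply: epsilon_trick => [k|]; [rewrite lee_fin rvol_ge0|rewrite addr_ge0// ltW].
Qed.

(** The single rectangle [r] is a cover within [left_open_square]; [covers_le] shows that no cover
    is cheaper. *)
Lemma cop_upint_box u v : 0 <= u <= 1 -> 0 <= v <= 1 ->
  cop_upint \1_(`[0, u] `*` `[0, v]) = (C (u, v))%:E.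
Proof.
move=> u01 v01; have /andP[u0 u1] := u01; have /andP[v0 v1] := v01.
have l01 := lexx 0 : 0 <= 0 :> R.
pose r : rect R := Rect (And3 l01 u0 u1) (And3 l01 v0 v1).
have rr : rvol C r = C (u, v) by rewrite /rvol /vol /= !copE ?lexx//=; lra.
apply/le_anti/andP; split.
  rewrite -rr; apply: (upint_fn_le indic_rect_ge0 (rvol_ge0 C) zero_rect) => //.
  move=> p [/= p1 p2]; rewrite !indicE ler_nat; case: (boolP (p \in _ `*` _)) => //.
  rewrite inE => -[/=]; rewrite !in_itv /= => /andP[_ pu] /andP[_ pv].
  rewrite mem_set//; split => /=; rewrite in_itv /= ?pu ?pv andbT.
    by move: p1; rewrite in_itv /= => /andP[].
  by move: p2; rewrite in_itv /= => /andP[].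
apply: le_ereal_inf_tmp => _ [s cs <-].
have [u00|u00] := eqVneq u 0.
  by rewrite u00 copE//; apply: nneseries_ge0 => k _ _; rewrite lee_fin rvol_ge0.
have [v00|v00] := eqVneq v 0.
  by rewrite v00 copE//; apply: nneseries_ge0 => k _ _; rewrite lee_fin rvol_ge0.
apply/lee_addgt0Pr => e e0; rewrite (_ : e = 4 * (e / 4)); last by field.
apply: covers_le; [by rewrite divr_gt0|by rewrite lt_neqAle eq_sym u00|
  by rewrite lt_neqAle eq_sym v00|].
move=> [x y] [/=]; rewrite !in_itv /= => /andP[x0 xu] /andP[y0 yv].
have /cs : left_open_square (x, y).
  by split; rewrite /= in_itv /= ?x0 ?y0 /=; lra.
rewrite indicE mem_set; last by split; rewrite /= in_itv /= ?xu ?yv ltW.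
apply: contraPP => nin; rewrite eseries0; first by rewrite lee_fin ler10.
move=> k _ _; rewrite indicE memNset// => kin; apply: nin; by exists k.
Qed.

Lemma cop_upint_measure : exists m : {measure set (R * R) -> \bar R},
  forall A, m A = cop_upint \1_A.
Proof.
have [m mE] := upint_measure indic_rect_ge0 (rvol_ge0 C) zero_rect
  splits_fst splits_snd (fun=> ler01).
by exists m => A; rewrite mE; apply: eq_upint => p _; rewrite mul1r.
Qed.

Lemma exists_measure_of : exists P : probability (R * R)%type R,
  is_measure_of C P /\ forall A, measurable A -> P A = cop_upint \1_A.
Proof.
have [m mE] := cop_upint_measure.
have i01 : 0 <= (1 : R) <= 1 by lra.
have m1 : m setT = 1%E.
  rewrite mE -[RHS](_ : (C (1, 1))%:E = 1%E); last by rewrite copE.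
  rewrite -cop_upint_box//; apply: eq_upint => p [p1 p2].
  move: p1 p2; rewrite /= !in_itv /= => /andP[/ltW p10 p11] /andP[/ltW p20 p21].
  by rewrite !indicE !mem_set//; split; rewrite /= in_itv /= ?p10 ?p20.
(* The mass is already 1, so normalizing only packs [m] as a probability and never returns the Dirac
   default. *)
exists (mnormalize m (\d_ ((0, 0) : R * R))).
have e A : mnormalize m (\d_ ((0, 0) : R * R)) A = m A.
  by rewrite /mnormalize m1 onee_eq0 /= invr1 mule1.
split=> [u v u01 v01|A _]; apply: (etrans (e _)); rewrite mE//.
exact: cop_upint_box.
Qed.

Lemma mu_P : is_measure_of C (mu_ C).
Proof.
by rewrite /mu_; case: xgetP => // n; have [P [/n]] := exists_measure_of.
Qed.

Section uniqueness.
Variable m : {measure set (R * R) -> \bar R}.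
Hypothesis m1 : m setT = 1%E.
Hypothesis mC : forall u v, 0 <= u <= 1 -> 0 <= v <= 1 ->
  m (`[0, u] `*` `[0, v]) = (C (u, v))%:E.

Let measurable_itvM (i j : interval R) : measurable ([set` i] `*` [set` j]).
Proof. by apply: measurableX; exact: measurable_itv. Qed.

Let fin A : measurable A -> (m A < +oo)%E.
Proof. by move=> mA; rewrite (@le_lt_trans _ _ (m setT)) ?le_measure ?inE// m1 ltry. Qed.

Let m_strip a b d : 0 <= a -> a <= b -> b <= 1 -> 0 <= d <= 1 ->
  m (`]a, b] `*` `[0, d]) = (C (b, d) - C (a, d))%:E.
Proof.
move=> a0 ab b1 d01.
have -> : `]a, b] `*` `[0, d] = (`[0, b] `*` `[0, d]) `\` (`[0, a] `*` `[0, d]).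
  apply/seteqP; split=> [[x y] [/=]|[x y] [[/=]]]; rewrite !in_itv /=.
    by move=> xab yd; split; [split => //; lra|case=> [xa _]; lra].
  move=> xb yd n; split => //; have [ax|xa] := ltP a x; first by lra.
  by exfalso; apply: n; split => //; lra.
rewrite measureD//; last exact: fin.
rewrite (_ : _ `&` _ = `[0, a] `*` `[0, d]).
  by rewrite /= !mC ?EFinB//; lra.
by apply/setIidPr => -[x y] [/=]; rewrite !in_itv /= => /andP[-> xa] ->; rewrite (le_trans xa).
Qed.

Let m_rect r : m (rect_set r) = (rvol C r)%:E.
Proof.
case: r => a b c d [a0 ab b1] [c0 cd d1]; rewrite /rect_set /rvol /=.
have -> : `]a, b] `*` `]c, d] = (`]a, b] `*` `[0, d]) `\` (`]a, b] `*` `[0, c]).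
  apply/seteqP; split=> [[x y] [/=]|[x y] [[/=]]]; rewrite !in_itv /=.
    by move=> xab yd; split; [split => //; lra|case=> [_ yc]; lra].
  move=> xb yd n; split => //; have [cy|yc] := ltP c y; first by lra.
  by exfalso; apply: n; split => //; lra.
rewrite measureD//; last exact: fin.
rewrite (_ : _ `&` _ = `]a, b] `*` `[0, c]).
  by rewrite /= !m_strip//; [rewrite -EFinB /vol; congr EFin; lra|lra|lra].
by apply/setIidPr => -[x y] [/=]; rewrite !in_itv /= => -> /andP[-> yc]; rewrite (le_trans yc).
Qed.

(** The values on boxes determine those on half-open rectangles, so the cost of a cover is the sum
    of the [m]-masses of its members. *)
Let m_le A : measurable A -> (m A <= cop_upint \1_A)%E.
Proof.
move=> mA; have l01 : [/\ 0 <= (0 : R), 0 <= (1 : R) & (1 : R) <= 1] by [].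
have mS : measurable left_open_square by exact: measurable_itvM.
have mSc : m (~` left_open_square) = 0%E.
  rewrite -setTD measureD//; last exact: fin.
  rewrite setTI /= m1.
  have -> : left_open_square = rect_set (Rect l01 l01) by [].
  by rewrite m_rect /rvol /vol /= !copE; [rewrite !subr0 addr0 subee|lra|lra|lra|lra].
rewrite (measureI_null mS mA mSc).
apply: le_ereal_inf_tmp => _ [s cs <-].
rewrite (eq_eseriesr (fun k _ => esym (m_rect (s k)))).
apply: (@measure_sigma_subadditive _ _ _ m _ (fun k => rect_set (s k))).
- by move=> k; exact: measurable_itvM.
- exact: measurableI.
move=> p [Ap Sp]; have /= := cs p Sp; rewrite indicE mem_set// => h.
apply: contrapT => nin; move: h; rewrite eseries0; first by rewrite lee_fin ler10.
by move=> k _ _; rewrite indicE memNset// => kin; apply: nin; exists k.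
Qed.

(* The inequality [m_le] for [A] and its complement must be an equality, since
   both sides have total mass 1. *)
Lemma measure_of_unique A : measurable A -> m A = cop_upint \1_A.
Proof.
move=> mA; have [P [_ PE]] := exists_measure_of.
have mAc : measurable (~` A) by exact: measurableC.
apply/le_anti; rewrite m_le//= -PE//.
have finP : P A \is a fin_num by rewrite fin_num_measure.
have : (P A + P (~` A) = m A + m (~` A))%E.
  by rewrite -!measureU//= ?setUv ?setICr// probability_setT m1.
move=> e; have := m_le mAc; rewrite -PE// => h.
have : (P A + P (~` A) <= m A + P (~` A))%E by rewrite e leeD2l.
by rewrite leeD2rE// fin_num_measure.
Qed.

End uniqueness.

Lemma mu_E A : measurable A -> mu_ C A = cop_upint \1_A.
Proof. by apply: measure_of_unique; [exact: probability_setT|exact: mu_P]. Qed.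

End copula_measure.
(** * Symmetries of copulas *)
Section symmetries.
Context {R : realType}.
Implicit Types (C D : copula R) (u v : R) (g : R * R -> R * R).

Lemma copula_eq C D :
  (forall u v, 0 <= u <= 1 -> 0 <= v <= 1 -> C (u, v) = D (u, v)) -> C = D.
Proof. by move=> CD; apply: copula_ext => -[u v] [u01 v01]; exact: CD. Qed.

Lemma swap_is_copula C : is_copula (fun p => C (swap_sym p)).
Proof.
split=> [p np|u u01|u u01|u u' v v' u0 uu' u'1 v0 vv' v'1] /=.
- by apply: cop_off => -[? ?]; apply: np.
- by rewrite /swap_sym /= !copE.
- by rewrite /swap_sym /= !copE.
- by rewrite /swap_sym /=; have := cop_2inc C v0 vv' v'1 u0 uu' u'1; rewrite /vol; lra.
Qed.

(** The reflection sends [[0, u]] to [[1 - u, 1]], and the strip over it up to height [v] has mass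
    [v - C (1 - u, v)]. *)
Lemma flip_is_copula C : is_copula (on_square (fun p => p.2 - C (flip_sym p))).
Proof.
split=> [p np|u u01|u u01|u u' v v' u0 uu' u'1 v0 vv' v'1] /=.
- exact: on_square_off.
- have c01 : 0 <= 1 - u <= 1 by lra.
  by rewrite !on_squareE ?lexx ?ler01//= /flip_sym /= subr0 !copE// !subrr.
- have c01 : 0 <= 1 - u <= 1 by lra.
  by rewrite !on_squareE ?lexx ?ler01//= /flip_sym /= subrr !copE//; split; lra.
- rewrite !on_squareE /=; try lra.
  have := @cop_2inc _ C (1 - u') (1 - u) v v'; rewrite /vol /flip_sym /= => h.
  have h1 : 0 <= 1 - u' by lra.
  have h2 : 1 - u' <= 1 - u by lra.
  have h3 : 1 - u <= 1 by lra.
  by have := h h1 h2 h3 v0 vv' v'1; lra.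
Qed.

Definition cop_swap C : copula R := Copula (swap_is_copula C).
Definition cop_flip C : copula R := Copula (flip_is_copula C).

Lemma cop_flipE C u v : 0 <= u <= 1 -> 0 <= v <= 1 ->
  cop_flip C (u, v) = v - C (1 - u, v).
Proof. by move=> u01 v01; rewrite /cop_flip /= on_squareE. Qed.

Lemma cop_swapK : involutive (@cop_swap).
Proof. by move=> C; apply: copula_ext => -[u v]. Qed.

Lemma cop_flipK : involutive (@cop_flip).
Proof.
move=> C; apply: copula_eq => u v u01 v01.
rewrite !cop_flipE//; last by lra.
by rewrite opprB addrC subrK; congr (C (_, _)); lra.
Qed.

Lemma cop_swap_Pi : cop_swap cop_Pi = cop_Pi.
Proof. by apply: copula_ext => -[u v] [/= u01 v01]; rewrite !on_squareE//= mulrC. Qed.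

Lemma cop_flip_Pi : cop_flip cop_Pi = cop_Pi.
Proof.
apply: copula_eq => u v u01 v01; rewrite cop_flipE//=.
by rewrite !on_squareE//=; [ring|lra].
Qed.

Lemma cop_flip_conv t (t01 : 0 <= t <= 1) C D :
  cop_flip (cop_conv t01 C D) = cop_conv t01 (cop_flip C) (cop_flip D).
Proof.
apply: copula_eq => u v u01 v01; rewrite cop_flipE//= -!/(cop_flip _ (u, v)).
by rewrite !on_squareE//= /flip_sym /=; ring.
Qed.

Lemma cop_swap_conv t (t01 : 0 <= t <= 1) C D :
  cop_swap (cop_conv t01 C D) = cop_conv t01 (cop_swap C) (cop_swap D).
Proof. by apply: copula_ext => -[u v] _. Qed.

Lemma measurable_swap_sym : measurable_fun setT (@swap_sym R).
Proof. by apply/measurable_fun_pairP; split; [exact: measurable_snd|exact: measurable_fst]. Qed.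

Lemma measurable_flip_sym : measurable_fun setT (@flip_sym R).
Proof.
apply/measurable_fun_pairP; split; last exact: measurable_snd.
by apply: measurable_funB => //; exact: measurable_fst.
Qed.

Lemma measurable_D4 g : D4 g -> measurable_fun setT g.
Proof.
elim=> [||| g1 g2 _ m1 _ m2].
- exact: measurable_id.
- exact: measurable_swap_sym.
- exact: measurable_flip_sym.
- exact: measurableT_comp.
Qed.

Lemma measurable_preimage g A : measurable_fun setT g -> measurable A ->
  measurable (g @^-1` A).
Proof. by move=> mg mA; rewrite -[_ @^-1` _]setTI; exact: mg. Qed.

Lemma pushforward_measure (m : {measure set (R * R) -> \bar R}) g :
  measurable_fun setT g ->
  exists m' : {measure set (R * R) -> \bar R}, forall A, m' A = pushforward m g A.
Proof. move=> mg; by exists (pushforward m g). Unshelve. all: exact: mg. Qed.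

Lemma mu_inj C D : (forall A, measurable A -> mu_ C A = mu_ D A) -> C = D.
Proof.
move=> CD; apply: copula_ext => -[u v] [/= u01 v01]; apply: EFin_inj.
rewrite -(mu_P C)// -(mu_P D)//; apply: CD.
by apply: measurableX; exact: measurable_itv.
Qed.

(** Replaces the choice operator by any explicit candidate, since a copula is determined by its
    measure. *)
Lemma cop_symE g C D :
  (forall A, measurable A -> mu_ D A = pushforward (mu_ C) g A) -> cop_sym g C = D.
Proof.
move=> mD; rewrite /cop_sym; case: xgetP => [E _ /= mE|/(_ D)//].
by apply: mu_inj => A mA; rewrite mE// mD.
Qed.

(** The pushforward is a measure of mass 1, so [measure_of_unique] reduces the claim to boxes at the
    origin. *)
Lemma mu_push g C D : measurable_fun setT g -> 
  (forall u v, 0 <= u <= 1 -> 0 <= v <= 1 ->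
     mu_ C (g @^-1` (`[0, u] `*` `[0, v])) = (D (u, v))%:E) ->
  forall A, measurable A -> mu_ D A = pushforward (mu_ C) g A.
Proof.
move=> mg e A mA; have [m' m'E] := pushforward_measure (mu_ C) mg.
rewrite mu_E// -m'E; apply/esym; apply: measure_of_unique => //.
  by rewrite m'E /pushforward preimage_setT; exact: probability_setT.
by move=> u v u01 v01; rewrite m'E; exact: e.
Qed.

Lemma mu_swap C A : measurable A -> mu_ (cop_swap C) A = pushforward (mu_ C) swap_sym A.
Proof.
apply: mu_push; first exact: measurable_swap_sym.
move=> u v u01 v01; rewrite -(mu_P C)//; congr (mu_ C _).
by apply/seteqP; split => -[x y] [].
Qed.

Lemma mu_flip C A : measurable A -> mu_ (cop_flip C) A = pushforward (mu_ C) flip_sym A.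
Proof.
apply: mu_push; first exact: measurable_flip_sym.
move=> u v u01 v01; rewrite cop_flipE//.
have i01 : 0 <= (1 : R) <= 1 by lra.
have mI (i j : interval R) : measurable ([set` i] `*` [set` j]).
  by apply: measurableX; exact: measurable_itv.
have fin A' : measurable A' -> mu_ C A' \is a fin_num by exact: fin_num_measure.
(* The preimage of a box is the full strip minus a strip open on the right; since [C] is
   1-Lipschitz, the missing edge has no mass. *)
have fl1 : mu_ C (`[0, 1 - u[ `*` `[0, v]) = (C (1 - u, v))%:E.
  apply/le_anti/andP; split.
    rewrite -(mu_P C)//; last by lra.
    rewrite le_measure ?inE//; apply: setSX => //.
    by apply: subset_itvl; rewrite bnd_simp.
  apply/lee_subgt0Pr => e e0; rewrite -EFinB.
  have [ue|ue] := leP (1 - u) e.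
    apply: le_trans (measure_ge0 _ _); rewrite lee_fin.
    have h0 : 0 <= 1 - u by lra.
    have h1 : 1 - u <= 1 by lra.
    by have := cop_incr1 C (lexx 0) h0 h1 v01; rewrite copE//; lra.
  have x01 : 0 <= 1 - u - e <= 1 by lra.
  apply: (@le_trans _ _ (mu_ C (`[0, 1 - u - e] `*` `[0, v]))).
    rewrite (mu_P C)// lee_fin.
    have h0 : 0 <= 1 - u - e by lra.
    have h1 : 1 - u - e <= 1 - u by lra.
    have h2 : 1 - u <= 1 by lra.
    by have := cop_incr1 C h0 h1 h2 v01; lra.
  rewrite le_measure ?inE//; apply: setSX => //.
  by apply: subset_itvl; rewrite bnd_simp; lra.
have sq : mu_ C (`[0, 1] `*` `[0, v]) = v%:E by rewrite (mu_P C)// copE.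
rewrite EFinB -sq -fl1.
have -> : flip_sym @^-1` (`[0, u] `*` `[0, v]) =
    (`[0, 1] `*` `[0, v]) `\` (`[0, 1 - u[ `*` `[0, v]).
  apply/seteqP; split=> [[x y] [/=]|[x y] [[/=]]]; rewrite !in_itv /=.
    by move=> xu yv; split; [split => //; lra|case=> [xa _]; lra].
  move=> x1 yv n; split => //; have [xu|ux] := ltP x (1 - u); last by lra.
  by exfalso; apply: n; split => //; lra.
rewrite measureD//=; last by rewrite -ge0_fin_numE// fin.
congr (_ - mu_ C _)%E; apply/setIidPr => -[x y] [/=]; rewrite !in_itv /= => xu ->.
by split => //; lra.
Qed.

Lemma cop_sym_swap C : cop_sym swap_sym C = cop_swap C.
Proof. by apply: cop_symE; exact: mu_swap. Qed.

Lemma cop_sym_flip C : cop_sym flip_sym C = cop_flip C.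
Proof. by apply: cop_symE; exact: mu_flip. Qed.

(** Induction on [D4], for all copulas at once, produces a copula whose measure is the pushforward;
    [cop_symE] identifies it. *)
Lemma mu_cop_sym g C A : D4 g -> measurable A ->
  mu_ (cop_sym g C) A = pushforward (mu_ C) g A.
Proof.
move=> Dg; suff ex D : exists E, forall A, measurable A -> mu_ E A = pushforward (mu_ D) g A.
  by have [E EP] := ex C; move=> mA; rewrite (cop_symE EP) EP.
elim: Dg D A => [D|D|D|g1 g2 D1 IH1 D2 IH2 D] _.
- by exists D.
- by exists (cop_swap D); exact: mu_swap.
- by exists (cop_flip D); exact: mu_flip.
(* [set0] fills a dummy argument left by generalizing over [A]. *)
- have [E2 P2] := IH2 D set0; have [E1 P1] := IH1 E2 set0; exists E1 => A mA.
  by rewrite P1// /pushforward P2//; apply: measurable_preimage => //; exact: measurable_D4.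
Qed.

Lemma cop_sym_id C : cop_sym id C = C.
Proof. exact: cop_symE. Qed.

Lemma cop_sym_comp g1 g2 C : D4 g1 -> D4 g2 ->
  cop_sym (g1 \o g2) C = cop_sym g1 (cop_sym g2 C).
Proof.
move=> D1 D2; apply: cop_symE => A mA; rewrite mu_cop_sym// /pushforward mu_cop_sym//.
by apply: measurable_preimage => //; exact: measurable_D4.
Qed.

End symmetries.
(** * Positive functionals on differences of copulas *)
Section copula_regularity.
Context {R : realType}.
Implicit Types (C D E : copula R) (u v : R) (p : R * R).

Lemma cop_not_open C D p : ~ open_square p -> C p = D p.
Proof.
have [[]|/[dup] /cop_off-> /cop_off-> //] := pselect (unit_square p).
case: p => u v /= /[dup] u01 /andP[u0 u1] /[dup] v01 /andP[v0 v1] nop.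
have [->|un0] := eqVneq u 0; first by rewrite !copE.
have [->|un1] := eqVneq u 1; first by rewrite !copE.
have [->|vn0] := eqVneq v 0; first by rewrite !copE.
have [->|vn1] := eqVneq v 1; first by rewrite !copE.
by exfalso; apply: nop; split => /=; rewrite !lt_neqAle ?u0 ?u1 ?v0 ?v1
  ?un1 ?vn1 ?(eq_sym 0) ?un0 ?vn0.
Qed.

Lemma open_unit p : open_square p -> unit_square p.
Proof. by move=> [/andP[a b] /andP[c d]]; split; rewrite !ltW. Qed.

Lemma cop_le_open C D : (forall p, open_square p -> C p <= D p) -> cop_le C D.
Proof.
move=> CD p _; have [/CD//|/(@cop_not_open C D)->//] := pselect (open_square p).
Qed.

Lemma open_square_itv : @open_square R = `]0, 1[ `*` `]0, 1[.
Proof. by apply/seteqP; split => -[x y] [/=]; rewrite !in_itv. Qed.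

Lemma measurable_open_square : measurable (@open_square R).
Proof. by rewrite open_square_itv; apply: measurableX; exact: measurable_itv. Qed.

Lemma open_open_square : open (@open_square R).
Proof.
rewrite open_square_itv (_ : _ `*` _ = fst @^-1` `]0, 1[ `&` snd @^-1` `]0, 1[)//.
apply: openI; apply: open_comp; try exact: itv_open.
- by move=> p _; exact: cvg_fst.
- by move=> p _; exact: cvg_snd.
Qed.

Lemma cop_cvg C p : open_square p -> C q @[q --> p] --> C p.
Proof.
move=> op; apply/cvgrPdist_le => e e0.
have nb : \forall q \near p, open_square q.
  by apply: open_nbhs_nbhs; split => //; exact: open_open_square.
have e2 : 0 < e / 2 by rewrite divr_gt0.
have nb1 : \forall q \near p, `|p.1 - q.1| <= e / 2.
  have c : fst q @[q --> p] --> p.1 by exact: cvg_fst.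
  by move/cvgrPdist_le : c; exact.
have nb2 : \forall q \near p, `|p.2 - q.2| <= e / 2.
  have c : snd q @[q --> p] --> p.2 by exact: cvg_snd.
  by move/cvgrPdist_le : c; exact.
near=> q; have oq : open_square q by near: q.
have [[? ?] [? ?]] := (open_unit op, open_unit oq).
have : `|C (p.1, p.2) - C (q.1, q.2)| <= `|p.1 - q.1| + `|p.2 - q.2|.
  exact: cop_lip.
rewrite -!surjective_pairing => /le_trans; apply.
by rewrite (splitr e); apply: lerD; near: q.
Unshelve. all: by end_near. Qed.

(** As [C] is monotone and continuous, the set where [C > a] is a countable union of quadrants above
    rational points at which [C] already exceeds [a]. *)
Lemma cop_measurable C : measurable_fun (@open_square R) C.
Proof.
move=> mS; apply: (measurability _ (RGenOInfty.measurableE R)) => // _ /= [_ [a ->] <-].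
pose Q (r s : rat) : set (R * R) :=
  if [&& 0 <= ratr r :> R, 0 <= ratr s :> R & a < C (ratr r, ratr s)] then
    open_square `&` (`[ratr r, +oo[ `*` `[ratr s, +oo[) else set0.
rewrite (_ : _ `&` _ = \bigcup_r \bigcup_s Q r s).
  apply: bigcupT_measurable_rat => r; apply: bigcupT_measurable_rat => s.
  rewrite /Q; case: ifP => // _; apply: measurableI => //.
  by apply: measurableX; exact: measurable_itv.
apply/seteqP; split=> [[u v] [op]|[u v] [r _ [s _]]]; rewrite /Q /=; last first.
  case: ifP => // /and3P[r0 s0 aC] [op [/=]]; rewrite !in_itv /= !andbT => ru sv.
  split => //; apply: lt_le_trans aC _; have [/= /andP[u0 u1] /andP[v0 v1]] := op.
  have r01 : 0 <= (ratr r : R) <= 1 by rewrite r0 /= (le_trans ru)// ltW.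
  have v01 : 0 <= v <= 1 by rewrite !ltW.
  have := cop_incr2 C s0 sv (ltW v1) r01.
  have := cop_incr1 C r0 ru (ltW u1) v01.
  by lra.
rewrite in_itv /= andbT => aC; have [/= /andP[u0 u1] /andP[v0 v1]] := op.
(* Lowering each coordinate by less than [e] lowers [C] by less than [2 * e], the excess over
   [a]. *)
pose e := (C (u, v) - a) / 2; have e0 : 0 < e by rewrite divr_gt0// subr_gt0.
have ue : Num.max 0 (u - e) < u by rewrite gt_max u0 gtrBl.
have ve : Num.max 0 (v - e) < v by rewrite gt_max v0 gtrBl.
have [r] := rat_in_itvoo ue; have [s] := rat_in_itvoo ve.
rewrite !in_itv /= !gt_max => /andP[/andP[s0 sv] sv'] /andP[/andP[r0 ru] ru'].
exists r => //; exists s => //; rewrite (ltW r0) (ltW s0) /=.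
have -> : a < C (ratr r, ratr s).
  have r01 : 0 <= (ratr r : R) <= 1 by rewrite ltW //= (le_trans (ltW ru'))// ltW.
  have v01 : 0 <= v <= 1 by rewrite !ltW.
  have := cop_incr2 C (ltW s0) (ltW sv') (ltW v1) r01.
  have := cop_incr1 C (ltW r0) (ltW ru') (ltW u1) v01.
  by move: ru sv; rewrite /e; lra.
by split => //; split; rewrite /= in_itv /= ltW.
Qed.

Lemma cop_w_ge0 p : 0 <= cop_w p :> R.
Proof.
rewrite subr_ge0; have [op|/(@cop_not_open cop_W cop_M)->//] := pselect (open_square p).
exact/cop_geW/open_unit.
Qed.

Lemma cop_dist_w C D p : `|C p - D p| <= cop_w p.
Proof.
have [/open_unit op|np] := pselect (open_square p); last first.
  by rewrite (@cop_not_open C D _ np) subrr normr0 cop_w_ge0.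
have := @cop_leM _ C _ op; have := @cop_leM _ D _ op.
have := @cop_geW _ C _ op; have := @cop_geW _ D _ op.
by rewrite ler_norml /cop_w; lra.
Qed.

End copula_regularity.

(** * Lipschitz cutoffs of differences of copulas *)

Section copula_cutoff.
Context {R : realType}.
Variables (chi : R -> R) (K : R).
Hypothesis K0 : 0 <= K.
Hypothesis chi01 : forall u, 0 <= chi u <= 1.
Hypothesis chi_lip : forall u u', u <= u' -> `|chi u' - chi u| <= K * (u' - u).
Variables D E : copula R.

(* Up to the factor [1 + K] this is [E + K * Pi + chi * (D - E)]: the rectangle
   volumes of the last term are at least [- vol E] plus a term bounded by
   [K * vol Pi]. *)
Lemma cutoff_is_copula : is_copula (fun p =>
  (E p + K * cop_Pi p + chi p.1 * (D p - E p)) / (1 + K)).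
Proof.
have K1 : 1 + K != 0 by apply: lt0r_neq0; have := K0; lra.
split=> [p np|u u01|u u01|u u' v v' u0 uu' u'1 v0 vv' v'1].
- by rewrite !cop_off//; lra.
- by rewrite !copE//; split; lra.
- rewrite !copE//; split; rewrite subrr mulr0 addr0 -[X in X + _]mul1r -mulrDl.
    by rewrite mulrAC divff// mul1r.
  by rewrite mulrAC divff// mul1r.
- pose g p := D p - E p; rewrite -!/(g _).
  have v01 : 0 <= v <= 1 by lra.
  have v'01 : 0 <= v' <= 1 by lra.
  have u01 : 0 <= u <= 1 by lra.
  have vD := cop_2inc D u0 uu' u'1 v0 vv' v'1.
  have vE := cop_2inc E u0 uu' u'1 v0 vv' v'1.
  have hD := cop_incr2 D v0 vv' v'1 u01.
  have hE := cop_incr2 E v0 vv' v'1 u01.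
  have hg : `|g (u, v') - g (u, v)| <= v' - v by rewrite ler_norml /g; lra.
  have h1 : chi u' * vol g u u' v v' >= - vol E u u' v v'.
    have -> : vol g u u' v v' = vol D u u' v v' - vol E u u' v v' by rewrite /vol /g; ring.
    have /andP[c0 c1] := chi01 u'.
    have := mulr_ge0 c0 vD; have := mulr_ge0 (_ : 0 <= 1 - chi u') vE.
    by rewrite subr_ge0 => /(_ c1); lra.
  have h2 : `|(chi u' - chi u) * (g (u, v') - g (u, v))| <= K * ((u' - u) * (v' - v)).
    by rewrite normrM mulrA; apply: ler_pM => //; exact: chi_lip.
  have vPi : vol cop_Pi u u' v v' = (u' - u) * (v' - v).
    rewrite /vol /= !on_squareE//=; [ring|lra..].
  move: h2; rewrite ler_norml => /andP[h2 _].
  have -> : forall a b c d, a / (1 + K) - b / (1 + K) - c / (1 + K) + d / (1 + K) =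
    (a - b - c + d) / (1 + K) by move=> *; field.
  rewrite divr_ge0//=; last by have := K0; lra.
  rewrite [X in 0 <= X](_ : _ = vol E u u' v v' + K * vol cop_Pi u u' v v' +
      chi u' * vol g u u' v v' + (chi u' - chi u) * (g (u, v') - g (u, v))).
    by rewrite vPi; lra.
  by rewrite /vol /g /=; ring.
Qed.

Lemma cutoff_base_is_copula : is_copula (fun p => (E p + K * cop_Pi p) / (1 + K)).
Proof.
have K1 : 1 + K != 0 by apply: lt0r_neq0; have := K0; lra.
have K01 : 0 <= K / (1 + K) <= 1.
  rewrite divr_ge0//=; last by have := K0; lra.
  by rewrite ler_pdivrMr ?mul1r; have := K0; lra.
rewrite [X in is_copula X](_ : _ = cop_conv K01 E cop_Pi :> (R * R -> R)); first exact: copulaP.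
by apply/funext => p /=; field.
Qed.

Lemma cutoff : exists D' E' : copula R,
  forall p, (1 + K) * (D' p - E' p) = chi p.1 * (D p - E p).
Proof.
have K1 : 1 + K != 0 by apply: lt0r_neq0; have := K0; lra.
exists (Copula cutoff_is_copula), (Copula cutoff_base_is_copula) => p /=.
by field.
Qed.

End copula_cutoff.

(** * The cone of weighted differences and its measure *)

Section positive_functional.
Context {R : realType}.
Variable Lam : copula R -> R.
Hypothesis Lconv : forall t (t01 : 0 <= t <= 1) C D,
  Lam (cop_conv t01 C D) = (1 - t) * Lam C + t * Lam D.
Hypothesis Lle : forall C D, cop_le C D -> Lam C <= Lam D.

(** The weight makes these differences a convex cone. A function may have several representations;
    by [wle] its cost does not depend on the one chosen. *)
Record wdiff := WDiff {
  wa : R ; wD : copula R ; wE : copula R ;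
  wa_ge0 : 0 <= wa ; wED : cop_le wE wD }.
Implicit Types (i j k l : wdiff).

Definition wfn i p := wa i * (wD i p - wE i p).
Definition wcost i := wa i * (Lam (wD i) - Lam (wE i)).

Lemma wfn_not_open i p : ~ open_square p -> wfn i p = 0.
Proof. by move=> np; rewrite /wfn (cop_not_open _ (wE i) np) subrr mulr0. Qed.

Lemma wfn_ge0 i p : 0 <= wfn i p.
Proof.
have [op|/wfn_not_open->//] := pselect (open_square p).
by rewrite mulr_ge0 ?wa_ge0// subr_ge0; exact/wED/open_unit.
Qed.

Lemma wcost_ge0 i : 0 <= wcost i.
Proof. by rewrite mulr_ge0 ?wa_ge0// subr_ge0; exact/Lle/wED. Qed.

Lemma cop_le_refl (C : copula R) : cop_le C C.
Proof. by []. Qed.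

Lemma wzero : exists2 i, (forall p, wfn i p = 0) & wcost i = 0.
Proof.
exists (WDiff (lexx 0) (@cop_le_refl cop_Pi)); rewrite /wcost ?mul0r//.
by move=> p; rewrite /wfn mul0r.
Qed.

Lemma wscale c i : 0 <= c ->
  exists2 j, (forall p, wfn j p = c * wfn i p) & wcost j = c * wcost i.
Proof.
move=> c0; exists (WDiff (mulr_ge0 c0 (wa_ge0 i)) (@wED i)).
  by move=> p; rewrite /wfn mulrA.
by rewrite /wcost mulrA.
Qed.

Let weight01 (a b : R) : 0 <= a -> 0 <= b -> 0 <= b / (a + b) <= 1.
Proof.
move=> a0 b0; rewrite divr_ge0 ?addr_ge0//=.
have := addr_ge0 a0 b0; rewrite le_eqVlt => /predU1P[<-|ab0].
  by rewrite invr0 mulr0.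
by rewrite ler_pdivrMr// mul1r lerDr.
Qed.

(** Homogeneous form of affinity. For [a = b = 0] the quotient is the default 0 and both sides
    vanish. *)
Let LconvE (a b : R) (a0 : 0 <= a) (b0 : 0 <= b) C D :
  (a + b) * Lam (cop_conv (weight01 a0 b0) C D) = a * Lam C + b * Lam D.
Proof.
have := addr_ge0 a0 b0; rewrite le_eqVlt => /predU1P[|ab0].
  move/esym/eqP; rewrite paddr_eq0// => /andP[/eqP e1 /eqP e2].
  by move: (Lam _) => x; rewrite e1 e2; ring.
rewrite Lconv; field; exact: lt0r_neq0.
Qed.

Let cop_convE (a b : R) (a0 : 0 <= a) (b0 : 0 <= b) C D p :
  (a + b) * cop_conv (weight01 a0 b0) C D p = a * C p + b * D p.
Proof.
have := addr_ge0 a0 b0; rewrite le_eqVlt => /predU1P[|ab0].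
  move/esym/eqP; rewrite paddr_eq0// => /andP[/eqP e1 /eqP e2].
  by move: (cop_conv _ _ _ p) => x; rewrite e1 e2; ring.
rewrite /=; field; exact: lt0r_neq0.
Qed.

(** With weights [a] and [b], the sum is [a + b] times a difference of convex combinations taken in
    the proportion of [a] to [b]. *)
Lemma wadd i j : exists2 k, (forall p, wfn k p = wfn i p + wfn j p) &
  wcost k = wcost i + wcost j.
Proof.
have ij := weight01 (wa_ge0 i) (wa_ge0 j).
have ED : cop_le (cop_conv (weight01 (wa_ge0 i) (wa_ge0 j)) (wE i) (wE j))
    (cop_conv (weight01 (wa_ge0 i) (wa_ge0 j)) (wD i) (wD j)).
  move=> p up /=; have /andP[t0 t1] := ij.
  by apply: lerD; apply: ler_wpM2l; rewrite ?subr_ge0//; exact: wED.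
exists (WDiff (addr_ge0 (wa_ge0 i) (wa_ge0 j)) ED) => [p|].
  by rewrite /wfn [_ * (_ - _)]mulrBr /wD /wE !cop_convE; ring.
by rewrite /wcost [_ * (_ - _)]mulrBr /wD /wE !LconvE; ring.
Qed.

(** The inequality [a (D - E) <= b (D' - E')] is rearranged to [a D + b E' <= a E + b D']. Divided
    by [a + b], it compares two copulas, to which [Lle] applies. *)
Lemma wle i j : (forall p, open_square p -> wfn i p <= wfn j p) -> wcost i <= wcost j.
Proof.
move=> ij; pose c1 := cop_conv (weight01 (wa_ge0 i) (wa_ge0 j)) (wD i) (wE j).
pose c2 := cop_conv (weight01 (wa_ge0 i) (wa_ge0 j)) (wE i) (wD j).
have := addr_ge0 (wa_ge0 i) (wa_ge0 j); rewrite le_eqVlt => /predU1P[|ab0].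
  move/esym/eqP; rewrite paddr_eq0 ?wa_ge0// => /andP[/eqP a0 /eqP b0].
  by rewrite /wcost a0 b0 !mul0r.
have /Lle : cop_le c1 c2.
  apply: cop_le_open => p /ij; rewrite /wfn => h.
  by rewrite -(ler_pM2l ab0) /c1 /c2 !cop_convE; lra.
move=> h; rewrite /wcost; move: h.
by rewrite -(ler_pM2l ab0) /c1 /c2 !LconvE; lra.
Qed.

Lemma wsum (s : nat -> wdiff) n :
  exists2 k, (forall p, wfn k p = \sum_(m < n) wfn (s m) p) &
             wcost k = \sum_(m < n) wcost (s m).
Proof.
elim: n => [|n [k kf kc]].
  by have [k kf kc] := wzero; exists k => [p|]; rewrite big_ord0.
have [l lf lc] := wadd k (s n).
by exists l => [p|]; rewrite big_ord_recr /= -?kf -?kc.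
Qed.

Lemma wcut1 (chi : R -> R) K i : 0 <= K -> (forall u, 0 <= chi u <= 1) ->
  (forall u u', u <= u' -> `|chi u' - chi u| <= K * (u' - u)) ->
  exists j, forall p, wfn j p = chi p.1 * wfn i p.
Proof.
move=> K0 chi01 chi_lip; have [D [E DE]] := cutoff K0 chi01 chi_lip (wD i) (wE i).
have K1 : 0 < 1 + K by lra.
have ED : cop_le E D.
  move=> p up; rewrite -subr_ge0 -(pmulr_rge0 _ K1) DE mulr_ge0//.
    by have /andP[] := chi01 p.1.
  by rewrite subr_ge0; exact: wED.
exists (WDiff (mulr_ge0 (wa_ge0 i) (ltW K1)) ED) => p.
by rewrite /wfn /= -mulrA DE; ring.
Qed.

Lemma wcut2 (chi : R -> R) K i : 0 <= K -> (forall u, 0 <= chi u <= 1) ->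
  (forall u u', u <= u' -> `|chi u' - chi u| <= K * (u' - u)) ->
  exists j, forall p, wfn j p = chi p.2 * wfn i p.
Proof.
move=> K0 chi01 chi_lip.
have swapP (C D : copula R) : cop_le C D -> cop_le (cop_swap C) (cop_swap D).
  by move=> CD [u v] [up vp]; apply: CD.
have [j jE] := wcut1 (WDiff (wa_ge0 i) (swapP _ _ (@wED i))) K0 chi01 chi_lip.
exists (WDiff (wa_ge0 j) (swapP _ _ (@wED j))) => -[u v].
exact: (jE (v, u)).
Qed.

Local Notation wupint := (upint wfn wcost (@open_square R)).

(* The cutoffs [chi n] increase to the indicator of the half-plane, so the
   increments of [chi n * wfn i] cover [wfn i] there, while each remainder
   [(1 - chi n) * wfn i] covers it on the complement. *)
Lemma wsplits (pr : R * R -> R) a :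
  (forall (chi : R -> R) K i, 0 <= K -> (forall u, 0 <= chi u <= 1) ->
    (forall u u', u <= u' -> `|chi u' - chi u| <= K * (u' - u)) ->
    exists j, forall p, wfn j p = chi (pr p) * wfn i p) ->
  splits wfn wcost (@open_square R) [set p | a < pr p].
Proof.
move=> cut i; pose chi n u : R := clamp 0 1 (n%:R * (u - a)).
have chi_itv n u : 0 <= chi n u <= 1 by exact: clamp_itv.
have chi_lip n u u' : u <= u' -> 0 <= chi n u' - chi n u <= n%:R * (u' - u).
  move=> uu'; have h : n%:R * (u - a) <= n%:R * (u' - a) by rewrite ler_wpM2l// lerB.
  rewrite subr_ge0 le_clamp//=; apply: le_trans (clamp_lip _ _ h) _.
  by rewrite -mulrBr; apply: ler_wpM2l => //; lra.
have chi_le n u : u <= a -> chi n u = 0.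
  by move=> ua; rewrite /chi clamp_le// mulr_ge0_le0// subr_le0.
have chi0 u : chi 0%N u = 0 by rewrite /chi mul0r clamp_le.
have chi_homo n u : chi n u <= chi n.+1 u.
  have [ua|au] := leP u a; first by rewrite !chi_le.
  by apply: le_clamp; apply: ler_wpM2r; rewrite ?ler_nat// subr_ge0 ltW.
have [s sE] : {s : nat -> wdiff & forall n, forall p,
    wfn (s n) p = (chi n.+1 (pr p) - chi n (pr p)) * wfn i p}.
  apply: (@choice _ _ (fun n j => forall p,
    wfn j p = (chi n.+1 (pr p) - chi n (pr p)) * wfn i p)) => n.
  apply: (cut (fun u => chi n.+1 u - chi n u) (n.+1%:R + n%:R)) => //.
  - move=> u; have := chi_homo n u; have := chi_itv n u; have := chi_itv n.+1 u; lra.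
  - move=> u u' uu'; have := chi_lip n _ _ uu'; have := chi_lip n.+1 _ _ uu'.
    by rewrite mulrDl ler_norml; lra.
have [t tE] : {t : nat -> wdiff & forall n, forall p,
    wfn (t n) p = (1 - chi n (pr p)) * wfn i p}.
  apply: (@choice _ _ (fun n j => forall p,
    wfn j p = (1 - chi n (pr p)) * wfn i p)) => n.
  apply: (cut (fun u => 1 - chi n u) n%:R) => //.
  - by move=> u; have := chi_itv n u; lra.
  - by move=> u u' uu'; have := chi_lip n _ _ uu'; rewrite ler_norml; lra.
have sum_s n p : \sum_(m < n) wfn (s m) p = chi n (pr p) * wfn i p.
  elim: n => [|n IH]; first by rewrite big_ord0 chi0 mul0r.
  by rewrite big_ord_recr /= IH sE; ring.
have cost_st n : \sum_(m < n) wcost (s m) + wcost (t n) <= wcost i.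
  have [k kf kc] := wsum s n; have [l lf lc] := wadd k (t n).
  rewrite -kc -lc; apply: wle => p _.
  by rewrite lf kf sum_s tE; lra.
have upH : (wupint (fun p => (wfn i p * \1_[set p | a < pr p] p)%R) <=
    \sum_(n <oo) (wcost (s n))%:E)%E.
  apply: upint_le_cover => p _; have s0 n : (0 <= (wfn (s n) p)%:E)%E by rewrite lee_fin wfn_ge0.
  rewrite indicE; case: (boolP (p \in _)) => /=; last first.
    by rewrite mulr0 => _; apply: nneseries_ge0.
  rewrite inE /= mulr1 => ap.
  pose n := (Num.truncn (1 / (pr p - a))).+1.
  have chin : chi n (pr p) = 1.
    rewrite /chi clamp_ge// -ler_pdivrMr ?subr_gt0//.
    by apply: ltW; exact: truncnS_gt.
  apply: le_trans (@nneseries_lim_ge _ _ xpredT _ n _) => //.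
  by rewrite big_mkord sumEFin sum_s chin mul1r.
have upHC n : (wupint (fun p => (wfn i p * \1_(~` [set p | a < pr p]) p)%R) <=
    (wcost (t n))%:E)%E.
  apply: (upint_fn_le wfn_ge0 wcost_ge0 wzero) => p _.
  rewrite indicE; case: (boolP (p \in _)) => /=; last by rewrite mulr0 wfn_ge0.
  by rewrite inE /= mulr1 => /negP; rewrite -leNgt tE => /chi_le->; rewrite subr0 mul1r.
have c0 n : xpredT n -> (0 <= (wcost (s n))%:E)%E by rewrite lee_fin wcost_ge0.
apply: le_trans (leeD upH (lexx _)) _.
set x := upint _ _ _ _ in upHC *.
have x0 : (0 <= x)%E by rewrite /x; apply: upint_ge0; exact: wcost_ge0.
have xfin : x \is a fin_num by rewrite ge0_fin_numE// (le_lt_trans (upHC 0%N))// ltry.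
rewrite -leeBrDr//; apply: lime_le.
  by apply: is_cvg_nneseries => n _; exact: c0.
apply: nearW => n; rewrite leeBrDr// big_mkord sumEFin.
apply: le_trans (leeD2l _ (upHC n)) _.
by rewrite -EFinD lee_fin.
Qed.


Lemma wfn_cvg i p : open_square p -> wfn i q @[q --> p] --> wfn i p.
Proof. by move=> op; apply: cvgMr; apply: cvgB; exact: cop_cvg. Qed.

Lemma wfn_measurable i : measurable_fun setT (wfn i).
Proof.
have -> : wfn i = (wfn i) \_ open_square.
  apply/funext => p; rewrite patchE; case: ifPn => // /negP np.
  by rewrite wfn_not_open// => /mem_set.
apply/(measurable_restrictT _ measurable_open_square).
by apply: measurable_funM => //; apply: measurable_funB; exact: cop_measurable.
Qed.

Definition w_index := WDiff (@ler01 R) (@cop_geW _ cop_M).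

Lemma w_indexE p : wfn w_index p = cop_w p.
Proof. by rewrite /wfn /= mul1r. Qed.

Lemma cop_w_ge (e : R) p : e <= p.1 <= 1 - e -> e <= p.2 <= 1 - e -> 0 <= e ->
  e <= cop_w p.
Proof.
case: p => u v /= u01 v01 e0; rewrite cop_wE; [|lra|lra].
by rewrite !le_min; apply/andP; split; apply/andP; split; lra.
Qed.

Definition box (e : R) : set (R * R) := `[e, 1 - e] `*` `[e, 1 - e].

(* Dini's theorem on the support of [wfn i]; the error is absorbed by [w], which
   is bounded below there. *)
Lemma wdini i (s : nat -> wdiff) (e : R) : 0 < e ->
  (forall p, ~ box e p -> wfn i p = 0) -> covers wfn (@open_square R) (wfn i) s ->
  ((wcost i)%:E <= \sum_(k <oo) (wcost (s k))%:E)%E.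
Proof.
move=> e0 supp cov; apply/lee_addgt0Pr => d d0.
have cw0 : 0 <= wcost w_index by exact: wcost_ge0.
(* Chosen so that the error function [d' * w] costs at most [d]; the [+ 1] avoids a zero
   denominator. *)
pose d' := d / (wcost w_index + 1).
have d'0 : 0 < d' by rewrite divr_gt0//; lra.
have de0 : 0 < d' * e by rewrite mulr_gt0.
have box_open p : box e p -> open_square p.
  by case: p => u v [/=]; rewrite !in_itv /= => ? ?; split => /=; lra.
have cpt : compact (box e) by apply: compact_setX; exact: segment_compact.
have nc : \forall n \near \oo, box e `<=`
    [set p | wfn i p <= \sum_(m < n) wfn (s m) p + d' * e].
  move/compact_near_coveringP : cpt; apply => p bp; have op := box_open p bp.
  have [N hN] : exists N, wfn i p < \sum_(m < N) wfn (s m) p + d' * e.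
    apply: contrapT => /forallNP h; have := cov p op; apply/negP; rewrite -ltNge.
    apply: (@le_lt_trans _ _ (wfn i p - d' * e)%:E); last by rewrite lte_fin; lra.
    apply: lime_le; first by apply: is_cvg_nneseries => n _; rewrite lee_fin wfn_ge0.
    apply: nearW => n; rewrite big_mkord sumEFin lee_fin.
    by have /negP := h n; rewrite -leNgt; lra.
  have [k kf _] := wsum s N.
  have : (fun q => wfn k q - wfn i q) @ p --> wfn k p - wfn i p.
    by apply: cvgB; exact: wfn_cvg.
  move=> /(cvgr_gt _) /(_ (- (d' * e))); rewrite kf => near_p.
  have {}near_p : \forall q \near p, - (d' * e) < wfn k q - wfn i q.
    by apply: near_p; lra.
  near=> q n => /=.
  have h1 : - (d' * e) < wfn k q - wfn i q by near: q.
  have h2 : (N <= n)%N by near: n; exact: nbhs_infty_ge.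
  have h3 : \sum_(m < N) wfn (s m) q <= \sum_(m < n) wfn (s m) q.
    rewrite -!(big_mkord xpredT (fun m => wfn (s m) q)).
    by rewrite [leRHS](big_cat_nat (n := N))//= lerDl sumr_ge0// => m _; exact: wfn_ge0.
  by rewrite kf in h1; lra.
have [n hn] : exists n, box e `<=` [set p | wfn i p <= \sum_(m < n) wfn (s m) p + d' * e].
  by case: nc => n _ /(_ n (leqnn n)); exists n.
have [k kf kc] := wsum s n; have [l lf lc] := wscale w_index (ltW d'0).
have [j jf jc] := wadd k l.
have : wcost i <= wcost j.
  apply: wle => p op; rewrite jf lf w_indexE.
  have [bp|/supp->] := pselect (box e p); last first.
    by rewrite addr_ge0 ?wfn_ge0// mulr_ge0 ?cop_w_ge0// ltW.
  apply: le_trans (hn p bp) _; rewrite kf lerD2l ler_wpM2l ?(ltW d'0)//.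
  move: bp => [/=]; rewrite !in_itv /= => b1 b2.
  exact: (cop_w_ge b1 b2 (ltW e0)).
rewrite jc lc kc => le.
apply: (@le_trans _ _ (\sum_(m < n) wcost (s m) + d)%:E).
  rewrite lee_fin (le_trans le)// lerD2l /d' mulrAC ler_pdivrMr; last lra.
  by rewrite ler_wpM2l ?ltW//; lra.
rewrite EFinD leeD2r// -sumEFin -(big_mkord xpredT (fun m => (wcost (s m))%:E)).
by apply: nneseries_lim_ge => m _; rewrite lee_fin wcost_ge0.
Unshelve. all: by end_near. Qed.

(** Equality of integral and cost comes from [wdini], hence only for functions supported in a [box];
    passing to the others is left to the continuity of the functional. The last clause holds
    because, for such a [nu], the cost of a cover is the integral of a function above the
    indicator. *)
Lemma positive_functional_measure :
  exists m : {measure set (R * R) -> \bar R},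
  [/\ m (~` open_square) = 0%E,
    forall i, (\int[m]_p (wfn i p)%:E <= (wcost i)%:E)%E,
    forall i (e : R), 0 < e -> (forall p, ~ box e p -> wfn i p = 0) ->
      (\int[m]_p (wfn i p)%:E)%E = (wcost i)%:E &
    forall nu : {measure set (R * R) -> \bar R}, nu (~` open_square) = 0%E ->
      (forall i, (\int[nu]_p (wfn i p)%:E)%E = (wcost i)%:E) ->
      forall A, measurable A -> (nu A <= m A)%E].
Proof.
have sp1 a : splits wfn wcost (@open_square R) [set p | a < p.1] := wsplits a wcut1.
have sp2 a : splits wfn wcost (@open_square R) [set p | a < p.2] := wsplits a wcut2.
have [m m_def] := upint_measure wfn_ge0 wcost_ge0 wzero sp1 sp2 (fun=> ler01).
have mE A : m A = upint wfn wcost (@open_square R) \1_A.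
  by rewrite m_def; apply: eq_upint => p _; rewrite mul1r.
have intE i : (\int[m]_p (wfn i p)%:E)%E = upint wfn wcost (@open_square R) (wfn i).
  apply: (integral_upint wfn_ge0 wcost_ge0 wzero sp1 sp2 wscale) => //.
  - exact: wfn_ge0.
  - exact: wfn_measurable.
exists m; split.
- rewrite mE; apply: (upint_eq0 wfn_ge0 wcost_ge0 wzero) => p op.
  by rewrite indicE memNset//; exact.
- by move=> i; rewrite intE; exact: (upint_fn_le wfn_ge0 wcost_ge0 wzero).
- move=> i e e0 supp; rewrite intE; apply/le_anti/andP; split.
    exact: (upint_fn_le wfn_ge0 wcost_ge0 wzero).
  by apply: le_ereal_inf_tmp => _ [s cs <-]; exact: wdini e0 supp cs.
- move=> nu nu0 nuE A mA; rewrite mE; apply: le_ereal_inf_tmp => _ [s cs <-].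
  under eq_eseriesr do rewrite -nuE.
  rewrite -integral_nneseries//; last 2 first.
  - by move=> n; apply/measurable_EFinP; exact: wfn_measurable.
  - by move=> n p _; rewrite lee_fin wfn_ge0.
  have mS := @measurable_open_square R.
  (* A cover dominates the indicator on the open square only, which is where [nu] lives. *)
  have -> : nu A = (\int[nu]_p (\1_(A `&` open_square) p)%:E)%E.
    rewrite integral_indic//=; last exact: measurableI.
    by rewrite setIT -(measureI_null mS mA nu0).
  apply: ge0_le_integral => //.
  + by apply/measurable_EFinP; apply: measurable_indic; exact: measurableI.
  + apply: ge0_emeasurable_sum => n.
      by move=> p _ _; rewrite lee_fin wfn_ge0.
    by move=> _; apply/measurable_EFinP; exact: wfn_measurable.
  + move=> p _; rewrite indicE; case: (boolP (p \in _)) => [|_].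
      rewrite inE => -[Ap op]; have := cs p op; rewrite indicE mem_set//.
    by apply: nneseries_ge0 => n _ _; rewrite lee_fin wfn_ge0.
Qed.

End positive_functional.

(** * Integrals against weighted measures *)

Section weighted_integrals.
Context {R : realType}.
Implicit Types (C D E : copula R) (m : {measure set (R * R) -> \bar R}).

Lemma cop_diff_integrable m C D : weighted_measure m ->
  m.-integrable open_square (EFin \o (fun p => C p - D p)).
Proof.
move=> [_ wfin].
have mCD C' D' : measurable_fun (@open_square R) (fun p => C' p - D' p :> R).
  by apply: measurable_funB; exact: cop_measurable.
apply: (@le_integrable _ _ _ _ _ _ _ (fun p => (cop_w p)%:E)).
- exact: measurable_open_square.
- by apply/measurable_EFinP; exact: mCD.
- move=> p _ /=; rewrite lee_fin; apply: le_trans (cop_dist_w _ _ _) _.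
  by rewrite ger0_norm// cop_w_ge0.
- apply/integrableP; split; first by apply/measurable_EFinP; exact: mCD.
  by under eq_integral do rewrite gee0_abs ?lee_fin ?cop_w_ge0//.
Qed.

Lemma int_cop_Pi m : int_cop cop_Pi m = 0.
Proof.
rewrite /int_cop; under eq_Rintegral do rewrite subrr.
by rewrite /Rintegral integral0_eq.
Qed.

Lemma int_copB m C D : weighted_measure m ->
  (\int[m]_(p in open_square) (C p - D p)%:E)%E = (int_cop C m - int_cop D m)%:E.
Proof.
move=> wm; rewrite /int_cop -RintegralB; first last.
- exact: cop_diff_integrable.
- exact: cop_diff_integrable.
- exact: measurable_open_square.
rewrite -[LHS]fineK; last exact:
  (integrable_fin_num measurable_open_square (cop_diff_integrable C D wm)).
by congr (_ %:E); apply: eq_Rintegral => p _; lra.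
Qed.

Lemma le_int_cop m C D : weighted_measure m -> cop_le C D ->
  int_cop C m <= int_cop D m.
Proof.
move=> wm CD; rewrite -subr_ge0 -lee_fin -int_copB//.
by apply: integral_ge0 => p /open_unit op; rewrite lee_fin subr_ge0 CD.
Qed.

Lemma int_cop_conv m t (t01 : 0 <= t <= 1) C D : weighted_measure m ->
  int_cop (cop_conv t01 C D) m = (1 - t) * int_cop C m + t * int_cop D m.
Proof.
move=> wm; have mS := @measurable_open_square R.
have i C' := cop_diff_integrable C' cop_Pi wm.
rewrite /int_cop -!RintegralZl// -RintegralD//.
- by apply: eq_Rintegral => p _ /=; ring.
- by have := integrableZl mS (1 - t) (i C); apply: eq_integrable => // p _ /=; rewrite EFinM.
- by have := integrableZl mS t (i D); apply: eq_integrable => // p _ /=; rewrite EFinM.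
Qed.

Lemma cop_w_weighted m : m (~` open_square) = 0%E ->
  (\int[m]_p (cop_w p)%:E < +oo)%E -> weighted_measure m.
Proof.
move=> m0 fin; split => //; rewrite integral_mkcond.
rewrite (_ : _ \_ _ = fun p => (cop_w p)%:E)//; apply/funext => p; rewrite patchE.
case: ifPn => // /negP np; rewrite /cop_w (cop_not_open _ cop_W) ?subrr//.
by move=> /mem_set.
Qed.

Lemma cop_int_open m C D : (\int[m]_(p in open_square) (C p - D p)%:E =
  \int[m]_p (C p - D p)%:E)%E.
Proof.
rewrite integral_mkcond (_ : _ \_ _ = fun p => (C p - D p)%:E)//.
apply/funext => p; rewrite patchE; case: ifPn => // /negP np; rewrite (cop_not_open _ D) ?subrr//.
by move=> /mem_set.
Qed.

End weighted_integrals.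

(** * Uniform convergence in terms of distances *)

Section uniform_convergence.
Context {R : realType}.

Lemma uniform_cvgP (A : set (R * R)) (f_ : nat -> R * R -> R) (f : R * R -> R) :
  {uniform A, f_ @ \oo --> f} <->
  forall e, 0 < e -> \forall n \near \oo, forall p, A p -> `|f p - f_ n p| < e.
Proof.
split=> [cf e e0|P].
  have nf : nbhs (f : {uniform` A -> R}) [set h | forall p, A p -> ball (f p) e (h p)].
    apply/uniform_nbhs; exists [set xy | ball xy.1 e xy.2]; split => //.
    exact: entourage_ball (PosNum e0).
  exact: (cf _ nf).
move=> Q /uniform_nbhs[E [entE EP]].
move: (entE); rewrite -entourage_ballE => -[e /= e0 ballE].
apply: filterS (P e e0) => n h; apply: EP => p Ap.
by apply: ballE; exact: h.
Qed.

End uniform_convergence.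
(** * The representation theorem *)
Section shrink.
Context {R : realType}.
Variable e : R.
Hypothesis e_itv : 0 < e < 2^-1.
Implicit Types (C D : copula R) (u v : R).

Definition stretch u : R := clamp 0 1 ((u - e) / (1 - 2 * e)).

Let c0 : 0 < 1 - 2 * e.
Proof. by have := e_itv; lra. Qed.

Lemma stretch_itv u : 0 <= stretch u <= 1.
Proof. exact: clamp_itv. Qed.

Lemma stretch_le u : u <= e -> stretch u = 0.
Proof.
by move=> ue; rewrite /stretch clamp_le// ler_pdivrMr ?c0// mul0r subr_le0.
Qed.

Lemma stretch_ge u : 1 - e <= u -> stretch u = 1.
Proof.
by move=> ue; rewrite /stretch clamp_ge// ler_pdivlMr ?c0// mul1r; lra.
Qed.

Lemma le_stretch u u' : u <= u' ->
  0 <= (1 - 2 * e) * (stretch u' - stretch u) <= u' - u.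
Proof.
move=> uu'; have h : (u - e) / (1 - 2 * e) <= (u' - e) / (1 - 2 * e).
  by rewrite ler_pM2r ?invr_gt0 ?c0// lerB.
rewrite mulr_ge0 ?(ltW c0) ?subr_ge0 ?le_clamp//= mulrC -ler_pdivlMr ?c0//.
apply: le_trans (clamp_lip 0 1 h) _; rewrite -mulrBl.
by apply: ler_wpM2r; rewrite ?invr_ge0 ?(ltW c0)//; lra.
Qed.

Lemma stretch_dist u : 0 <= u <= 1 -> `|stretch u - u| <= e.
Proof.
move=> u01; have e0 := e_itv; have [ue|eu] := leP u e.
  by rewrite stretch_le// ler_norml; lra.
have [ue|ue] := leP (1 - e) u.
  by rewrite stretch_ge// ler_norml; lra.
have -> : stretch u = (u - e) / (1 - 2 * e).
  rewrite /stretch clamp_id// divr_ge0//=; [|lra|lra].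
  by rewrite ler_pdivrMr ?c0//; lra.
have -> : (u - e) / (1 - 2 * e) - u = e * ((2 * u - 1) / (1 - 2 * e)).
  by field; exact: lt0r_neq0.
rewrite normrM gtr0_norm; last by lra.
rewrite ger_pMr; last by lra.
rewrite normrM normfV (gtr0_norm c0) ler_pdivrMr ?c0// mul1r ler_norml.
by apply/andP; split; lra.
Qed.

Let shrink_fun C (p : R * R) := p.1 * p.2 + (1 - 2 * e) ^+ 2 *
  (C (stretch p.1, stretch p.2) - stretch p.1 * stretch p.2).

(** The volume is that of [Pi], minus the rescaled volume of [Pi], plus the rescaled volume of [C].
    The first difference is non-negative because [stretch] times [1 - 2 * e] is monotone and
    1-Lipschitz. *)
Lemma shrink_is_copula C : is_copula (on_square (shrink_fun C)).
Proof.
have s0 : stretch 0 = 0 by apply: stretch_le; have := e_itv; lra.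
have s1 : stretch 1 = 1 by apply: stretch_ge; have := e_itv; lra.
split=> [p|u u01|u u01|u u' v v' u0 uu' u'1 v0 vv' v'1].
- exact: on_square_off.
- rewrite !on_squareE ?lexx ?ler01//= /shrink_fun /= s0 !copE ?stretch_itv//.
  by split; ring.
- rewrite !on_squareE ?lexx ?ler01//= /shrink_fun /= s1 !copE ?stretch_itv//.
  by split; ring.
- rewrite !on_squareE /=; try lra.
  have /andP[su0 suu'] := le_stretch uu'; have /andP[sv0 svv'] := le_stretch vv'.
  have /andP[a0 _] := stretch_itv u; have /andP[_ a1] := stretch_itv u'.
  have /andP[b0 _] := stretch_itv v; have /andP[_ b1] := stretch_itv v'.
  have va : stretch u <= stretch u' by rewrite -subr_ge0 -(pmulr_rge0 _ c0).
  have vb : stretch v <= stretch v' by rewrite -subr_ge0 -(pmulr_rge0 _ c0).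
  have vC := cop_2inc C a0 va a1 b0 vb b1.
  have h1 : (1 - 2 * e) ^+ 2 * vol C (stretch u) (stretch u') (stretch v) (stretch v') >= 0.
    by rewrite mulr_ge0// sqr_ge0.
  have h2 := ler_pM su0 sv0 suu' svv'.
  rewrite [X in 0 <= X](_ : _ = (u' - u) * (v' - v) -
      ((1 - 2 * e) * (stretch u' - stretch u)) * ((1 - 2 * e) * (stretch v' - stretch v))
      + (1 - 2 * e) ^+ 2 * vol C (stretch u) (stretch u') (stretch v) (stretch v')).
    by lra.
  by rewrite /shrink_fun /vol /=; ring.
Qed.

(* [mu_C] rescaled to the square [e, 1 - e]^2 replaces the mass of [Pi] there. *)
Definition shrink C : copula R := Copula (shrink_is_copula C).

Lemma shrinkE C u v : 0 <= u <= 1 -> 0 <= v <= 1 ->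
  shrink C (u, v) = shrink_fun C (u, v).
Proof. exact: on_squareE. Qed.

Lemma shrink_le C D : cop_le C D -> cop_le (shrink C) (shrink D).
Proof.
move=> CD [u v] [u01 v01]; rewrite !shrinkE//= lerD2l ler_wpM2l ?sqr_ge0// lerD2r.
by apply: CD; split; exact: stretch_itv.
Qed.

Lemma shrink_box C D p : ~ (`[e, 1 - e] `*` `[e, 1 - e]) p -> shrink C p = shrink D p.
Proof.
have [[]|np _] := pselect (unit_square p); last by rewrite !cop_off.
case: p => u v u01 v01 nb; rewrite /= in u01 v01; rewrite !shrinkE// /shrink_fun /=.
congr (_ + _ * (_ - _)).
have [ue|eu] := leP u e; first by rewrite stretch_le// !copE ?stretch_itv.
have [ve|ev] := leP v e; first by rewrite (stretch_le ve)// !copE ?stretch_itv.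
have [ue|ue] := leP (1 - e) u; first by rewrite stretch_ge// !copE ?stretch_itv.
have [ve|ve] := leP (1 - e) v; first by rewrite (stretch_ge ve)// !copE ?stretch_itv.
by exfalso; apply: nb; split; rewrite /= in_itv /= !ltW.
Qed.

(** A generous constant: the moves of [C] and of the product contribute [2 * e] each, and the lost
    factor [1 - (1 - 2 * e) ^+ 2] at most [4 * e]. *)
Lemma shrink_dist C p : unit_square p -> `|C p - shrink C p| <= 12 * e.
Proof.
case: p => u v [u01 v01]; rewrite /= in u01 v01; rewrite shrinkE// /shrink_fun /=.
set x := stretch u; set y := stretch v.
have x01 : 0 <= x <= 1 by exact: stretch_itv.
have y01 : 0 <= y <= 1 by exact: stretch_itv.
have hx : `|x - u| <= e by exact: stretch_dist.
have hy : `|y - v| <= e by exact: stretch_dist.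
have hC := cop_lip C u01 x01 v01 y01.
have hP := cop_lip cop_Pi u01 x01 v01 y01.
have PE a b : 0 <= a <= 1 -> 0 <= b <= 1 -> cop_Pi (a, b) = a * b :> R.
  by move=> a01 b01; rewrite /= on_squareE.
rewrite !PE// in hP.
have C01 : 0 <= C (x, y) <= 1.
  rewrite cop_ge0 /=; have := @cop_leM _ C (x, y) (conj x01 y01).
  by rewrite /= on_squareE//= le_min => /andP[h _]; apply: le_trans h _; lra.
have xy01 : 0 <= x * y <= 1.
  have /andP[? ?] := x01; have /andP[? ?] := y01.
  by rewrite mulr_ge0//= mulr_ile1.
have d01 : `|C (x, y) - x * y| <= 1 by rewrite ler_norml; lra.
have e0 := e_itv.
have hk : `|(4 * e - 4 * e ^+ 2) * (C (x, y) - x * y)| <= 4 * e.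
  rewrite normrM -[leRHS]mulr1 ler_pM// ger0_norm; first by have := sqr_ge0 e; lra.
  by rewrite expr2 -mulrBr mulr_ge0//; have := ler_wpM2l (_ : 0 <= e) (_ : e <= 1); lra.
have -> : C (u, v) - (u * v + (1 - 2 * e) ^+ 2 * (C (x, y) - x * y)) =
  - (C (x, y) - C (u, v)) + (x * y - u * v) + (4 * e - 4 * e ^+ 2) * (C (x, y) - x * y) by ring.
apply: le_trans (ler_normD _ _) _; apply: le_trans (lerD (ler_normD _ _) (lexx _)) _.
rewrite normrN; lra.
Qed.

End shrink.

(** * Equality of a measure with one that dominates it *)

Section comparison.
Context {R : realType}.
Variables m nu : {measure set (R * R) -> \bar R}.
Hypotheses (wm : weighted_measure m) (wnu : weighted_measure nu).
Hypothesis le_nu : forall A, measurable A -> (nu A <= m A)%E.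
Hypothesis eq_w :
  (\int[m]_(p in open_square) (cop_w p)%:E <= \int[nu]_(p in open_square) (cop_w p)%:E)%E.

Let mw : measurable_fun setT (fun p : R * R => (cop_w p)%:E).
Proof.
rewrite (_ : (fun p => _) = (fun p : R * R => (cop_w p)%:E) \_ open_square).
  apply/(measurable_restrictT _ (@measurable_open_square R)).
  by apply/measurable_EFinP; apply: measurable_funB; exact: cop_measurable.
apply/funext => p; rewrite patchE; case: ifPn => // /negP np.
by rewrite /cop_w (cop_not_open _ cop_W) ?subrr// => /mem_set.
Qed.

Let w0 (p : R * R) : (0 <= (cop_w p)%:E :> \bar R)%E.
Proof. by rewrite lee_fin cop_w_ge0. Qed.

Let fin_w (A : set (R * R)) (mu : {measure set (R * R) -> \bar R}) : weighted_measure mu ->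
  measurable A -> A `<=` open_square -> (\int[mu]_(p in A) (cop_w p)%:E < +oo)%E.
Proof.
move=> [_ wfin] mA AS; apply: le_lt_trans wfin; apply: ge0_subset_integral => //.
- exact: measurable_open_square.
- exact: measurable_funTS.
Qed.

(* On [A] inside [{w >= e}] write [w = e + (w - e)]: the smaller measure would
   give strictly less weight to [w] if it gave less mass to [A]. *)
Let eq_on (A : set (R * R)) e : 0 < e -> measurable A -> A `<=` open_square ->
  (forall p, A p -> e <= cop_w p) -> nu A = m A.
Proof.
move=> e0 mA AS Ae; have mS := @measurable_open_square R.
apply/le_anti; rewrite le_nu//=.
have mB : measurable (open_square `\` A) by exact: measurableD.
have split_w (mu : {measure set (R * R) -> \bar R}) :
    (\int[mu]_(p in open_square) (cop_w p)%:E = \int[mu]_(p in A) (cop_w p)%:E +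
     \int[mu]_(p in open_square `\` A) (cop_w p)%:E)%E.
  rewrite -[in LHS](setDUK AS) ge0_integral_setU//; first exact: measurable_funTS.
  by apply/disj_setPS => p [Ap [_ nAp]].
have le_B : (\int[nu]_(p in open_square `\` A) (cop_w p)%:E <=
    \int[m]_(p in open_square `\` A) (cop_w p)%:E)%E by exact: ge0_le_measure_integral.
have finB mu : weighted_measure mu ->
    (\int[mu]_(p in open_square `\` A) (cop_w p)%:E \is a fin_num)%E.
  by move=> wmu; rewrite ge0_fin_numE ?integral_ge0// fin_w//; exact: subDsetl.
have le_A : (\int[m]_(p in A) (cop_w p)%:E <= \int[nu]_(p in A) (cop_w p)%:E)%E.
  move: eq_w; rewrite !split_w => h; rewrite -(leeD2rE _ _ (finB _ wm)).
  by apply: le_trans h _; apply: leeD2l.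
have mwe : measurable_fun setT (fun p : R * R => (Num.max 0 (cop_w p - e))%:E).
  apply/measurable_EFinP; apply: measurable_maxr => //; apply: measurable_funB => //.
  exact/measurable_EFinP.
have we0 (p : R * R) : (0 <= (Num.max 0 (cop_w p - e))%:E :> \bar R)%E.
  by rewrite lee_fin le_max lexx.
have split_A (mu : {measure set (R * R) -> \bar R}) :
    (\int[mu]_(p in A) (cop_w p)%:E =
     e%:E * mu A + \int[mu]_(p in A) (Num.max 0 (cop_w p - e))%:E)%E.
  rewrite -(integral_cst mu mA) -ge0_integralD//.
  - apply: eq_integral => p; rewrite inE => Ap; rewrite -EFinD; congr EFin.
    by rewrite max_r ?subr_ge0 ?Ae//; ring.
  - by move=> p _; rewrite lee_fin ltW.
  - exact: measurable_funTS.
have le_we : (\int[nu]_(p in A) (Num.max 0 (cop_w p - e))%:E <=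
    \int[m]_(p in A) (Num.max 0 (cop_w p - e))%:E)%E by exact: ge0_le_measure_integral.
have fin_we : (\int[nu]_(p in A) (Num.max 0 (cop_w p - e))%:E \is a fin_num)%E.
  rewrite ge0_fin_numE ?integral_ge0//; apply: le_lt_trans (fin_w wnu mA AS).
  by rewrite split_A leeDr// mule_ge0// lee_fin ltW.
move: le_A; rewrite !split_A => le_A.
have : (e%:E * m A + \int[nu]_(p in A) (Num.max 0 (cop_w p - e))%:E <=
  e%:E * nu A + \int[nu]_(p in A) (Num.max 0 (cop_w p - e))%:E)%E.
  by apply: le_trans le_A; exact: leeD2l.
by rewrite leeD2rE// lee_pmul2l.
Qed.

(** Since [w] is positive on the open square, the sets where [w] is at least [1 / (n + 1)] exhaust
    it; continuity from below extends [eq_on]. *)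
Lemma weighted_measure_eq A : measurable A -> nu A = m A.
Proof.
move=> mA; have mS := @measurable_open_square R.
rewrite (measureI_null mS mA wnu.1) (measureI_null mS mA wm.1).
pose B n := A `&` open_square `&` [set p | n.+1%:R^-1 <= cop_w p].
have mB n : measurable (B n).
  apply: measurableI; first exact: measurableI.
  rewrite -[X in measurable X]setTI; apply: measurable_fun_le => //.
  exact/measurable_EFinP.
have BE : \bigcup_n B n = A `&` open_square.
  apply/seteqP; split=> [p [n _ []]//|p [Ap Sp]].
  have w_gt0 : 0 < cop_w p :> R.
    case: p Sp {Ap} => u v [/= u01 v01]; rewrite cop_wE; [|lra|lra].
    by rewrite !lt_min; apply/andP; split; apply/andP; split; lra.
  exists (Num.truncn (cop_w p)^-1) => //; split => //=.
  by rewrite -[leRHS]invrK lef_pV2 ?posrE ?invr_gt0// ltW// truncnS_gt.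
have ndB : nondecreasing_seq B.
  move=> i j ij; apply/subsetPset => p [ASp /= h]; split => //=; apply: le_trans h.
  by rewrite lef_pV2 ?posrE// ler_nat.
have cvgB' (mu : {measure set (R * R) -> \bar R}) :
    mu \o B @ \oo --> mu (A `&` open_square).
  by rewrite -BE; apply: nondecreasing_cvg_mu => //; rewrite BE; exact: measurableI.
rewrite -(cvg_lim _ (cvgB' nu))// -(cvg_lim _ (cvgB' m))//; congr (lim (_ @ \oo)).
apply/funext => n /=; apply: (@eq_on _ n.+1%:R^-1) => //.
  by move=> p [[]].
by move=> p [].
Qed.

End comparison.

Section representation.
Context {R : realType}.
Variable Lam : copula R -> R.
Hypothesis Lconv : forall t (t01 : 0 <= t <= 1) C D,
  Lam (cop_conv t01 C D) = (1 - t) * Lam C + t * Lam D.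
Hypothesis Lle : forall C D, cop_le C D -> Lam C <= Lam D.
Hypothesis Lcvg : forall (C_ : nat -> copula R) (C : copula R),
  {uniform unit_square, (fun n => C_ n : R * R -> R) @ \oo --> (C : R * R -> R)} ->
  Lam (C_ n) @[n --> \oo] --> Lam C.

(** Starting at 1/3 keeps every term below one half, as [shrink] requires. *)
Let e_ n : R := n.+3%:R^-1.

Let e_itv n : 0 < e_ n < 2^-1.
Proof. by rewrite /e_ invr_gt0 ltr0n /= ltf_pV2 ?posrE// ltr_nat. Qed.

Let e_cvg : e_ n @[n --> \oo] --> (0 : R).
Proof.
rewrite /e_; have := @cvg_harmonic R; rewrite -(cvg_shiftn 2).
by under eq_fun do rewrite /= /harmonic addn2.
Qed.

Let shrink_cvg C : {uniform unit_square,
  (fun n => shrink (e_itv n) C : R * R -> R) @ \oo --> (C : R * R -> R)}.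
Proof.
apply/uniform_cvgP => d d0; near=> n => p up.
apply: le_lt_trans (shrink_dist _ _ up) _; rewrite mulrC -ltr_pdivlMr//.
by near: n; apply: (cvgr_lt _ e_cvg); rewrite divr_gt0.
Unshelve. all: by end_near. Qed.

Theorem representation : exists m : {measure set (R * R) -> \bar R},
  [/\ weighted_measure m, forall D, int_cop D m = Lam D - Lam cop_Pi &
      forall nu, weighted_measure nu -> (forall D, int_cop D nu = Lam D - Lam cop_Pi) ->
        forall A, measurable A -> nu A = m A].
Proof.
have [m [m0 m_le m_eq m_max]] := positive_functional_measure Lconv Lle.
have wm : weighted_measure m.
  apply: cop_w_weighted => //.
  rewrite (eq_integral (fun p => (wfn (@w_index R) p)%:E)); last by move=> p _; rewrite w_indexE.
  by apply: le_lt_trans (m_le _) _; rewrite ltry.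
have WD D n : cop_le (shrink (e_itv n) cop_W) (shrink (e_itv n) D).
  by apply: shrink_le; exact: cop_geW.
(* The shrunk copies of [D] and [W] are ordered and agree off a box, so the integral of their
   difference is exactly its cost. *)
have intn D n :
   (\int[m]_(p in open_square) (shrink (e_itv n) D p - shrink (e_itv n) cop_W p)%:E =
    (Lam (shrink (e_itv n) D) - Lam (shrink (e_itv n) cop_W))%:E)%E.
  have /andP[en _] := e_itv n.
  have -> : Lam (shrink (e_itv n) D) - Lam (shrink (e_itv n) cop_W) =
      wcost Lam (WDiff ler01 (@WD D n)) by rewrite /wcost mul1r.
  rewrite -(m_eq _ (e_ n))//; last first.
    move=> p nb; have eDW := shrink_box (e_itv n) D cop_W nb.
    by rewrite /wfn -[wD _ p]/(shrink (e_itv n) D p) eDW subrr mulr0.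
  by rewrite cop_int_open; apply: eq_integral => p _; rewrite /wfn mul1r.
have lim1 D :
  (\int[m]_(p in open_square) (shrink (e_itv n) D p - shrink (e_itv n) cop_W p)%:E)%E
    @[n --> \oo] --> (\int[m]_(p in open_square) (D p - cop_W p)%:E)%E.
  have mS := @measurable_open_square R.
  have ptw C p : open_square p -> shrink (e_itv n) C p @[n --> \oo] --> C p.
    move=> op; apply/cvgrPdist_lt => d d0.
    have := (uniform_cvgP _ _ _).1 (@shrink_cvg C) d d0.
    by apply: filterS => n h; apply: h; exact: open_unit.
  have mCD (C' D' : copula R) :
      measurable_fun (@open_square R) (fun p => (C' p - D' p)%:E : \bar R).
    have ? : measurable_fun (@open_square R) (fun p => C' p - D' p).
      by apply: measurable_funB; exact: cop_measurable.
    exact/measurable_EFinP.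
  have [] := @dominated_convergence _ _ _ m open_square mS
    (fun n p => (shrink (e_itv n) D p - shrink (e_itv n) cop_W p)%:E)
    (fun p => (D p - cop_W p)%:E) (fun p => (cop_w p)%:E) _ _ _ _ _ => //.
  - apply: aeW => p op; apply: cvg_EFin; first by apply: nearW.
    by apply: cvgB; exact: ptw.
  - exact: cop_diff_integrable.
  - apply: aeW => p n _.
    by have := cop_dist_w (shrink (e_itv n) D) (shrink (e_itv n) cop_W) p; rewrite -lee_fin.
have lim2 D :
  (\int[m]_(p in open_square) (shrink (e_itv n) D p - shrink (e_itv n) cop_W p)%:E)%E
    @[n --> \oo] --> (Lam D - Lam cop_W)%:E.
  under eq_fun do rewrite intn.
  by apply: cvg_EFin; [exact: nearW|apply: cvgB; apply: Lcvg; exact: shrink_cvg].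
have intW D : int_cop D m - int_cop cop_W m = Lam D - Lam cop_W.
  apply: EFin_inj; rewrite -int_copB//.
  exact: cvg_unique (lim1 D) (lim2 D).
(* Subtracting the case [D = Pi] moves the base point from [W] to [Pi]. *)
have intD D : int_cop D m = Lam D - Lam cop_Pi.
  by have := intW D; have := intW cop_Pi; rewrite int_cop_Pi; lra.
exists m; split => // nu wnu intnu A mA.
have intE mu (i : @wdiff R) : weighted_measure mu ->
    (forall D, int_cop D mu = Lam D - Lam cop_Pi) ->
    (\int[mu]_p (wfn i p)%:E)%E = (wcost Lam i)%:E.
  move=> wmu h; have mS := @measurable_open_square R.
  transitivity (\int[mu]_(p in open_square) (wfn i p)%:E)%E.
    rewrite [RHS]integral_mkcond; apply: eq_integral => p _; rewrite patchE.
    by case: ifPn => // /negP np; rewrite wfn_not_open// => /mem_set.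
  rewrite /wfn; under eq_integral do rewrite EFinM.
  rewrite integralZl//; last exact: cop_diff_integrable.
  by rewrite int_copB// -EFinM !h /wcost; congr EFin; ring.
apply: weighted_measure_eq => //.
  by apply: m_max; [case: wnu|move=> i; exact: intE].
by rewrite /cop_w !int_copB// !intD !intnu.
Qed.

End representation.
(** * Measures of concordance of degree at most two *)
Section copula_topology.
Context {R : realType}.
Implicit Types (C D E : copula R).

Lemma nbhs_copulaP C (A : set (copula R)) : nbhs C A <->
  exists2 e, 0 < e & forall D, (forall p, unit_square p -> `|C p - D p| < e) -> A D.
Proof.
split=> [[_ [[B Bop <-] BC] sub]|[e e0 eA]].
  have /uniform_nbhs[E [entE EB]] : nbhs (copula_uniform C) B by exact: open_nbhs_nbhs.
  move: entE; rewrite -entourage_ballE => -[e /= e0 ballE].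
  by exists e => // D CD; apply: sub; apply: EB => p up; apply: ballE; exact: CD.
have nf : nbhs (copula_uniform C) [set h | forall p, unit_square p -> ball (C p) e (h p)].
  apply/uniform_nbhs; exists [set xy | ball xy.1 e xy.2]; split => //.
  exact: entourage_ball (PosNum e0).
have nC : nbhs C (@copula_uniform R @^-1`
  [set h | forall p, unit_square p -> ball (C p) e (h p)]).
  exact: (@initial_continuous _ _ (@copula_uniform R) C _ nf).
by apply: (@filterS _ (nbhs C) _ _ _ _ nC) => D; exact: eA.
Qed.

Lemma cvg_copula (C_ : nat -> copula R) C :
  {uniform unit_square, (fun n => C_ n : R * R -> R) @ \oo --> (C : R * R -> R)} ->
  C_ @ \oo --> C.
Proof.
move=> /uniform_cvgP cC A /nbhs_copulaP[e e0 eA].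
by apply: filterS (cC e e0) => n; exact: eA.
Qed.

(** Bridges (A5), stated with sequences, and (P5), stated with the topology: a discontinuity at [C]
    yields points within [1 / (n + 1)] of [C] whose values stay away. *)
Lemma sequential_continuous (kappa : copula R -> R) :
  (forall (C_ : nat -> copula R) C,
    {uniform unit_square, (fun n => C_ n : R * R -> R) @ \oo --> (C : R * R -> R)} ->
    kappa (C_ n) @[n --> \oo] --> kappa C) -> continuous kappa.
Proof.
move=> kcvg C A /nbhs_ballP[e /= e0 eA].
suff : nbhs C [set D | `|kappa C - kappa D| < e].
  by move=> /nbhs_copulaP[d d0 h]; apply/nbhs_copulaP; exists d => // D /h /eA.
apply/nbhs_copulaP; apply: contrapT => none.
have far n : exists D, (forall p, unit_square p -> `|C p - D p| < n.+1%:R^-1) /\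
    ~ (`|kappa C - kappa D| < e).
  apply: contrapT => /forallNP h; apply: none; exists n.+1%:R^-1; first by rewrite invr_gt0.
  by move=> D CD; apply: contrapT => ne; exact: h D (conj CD ne).
have [C_ CP] := choice far.
have : kappa (C_ n) @[n --> \oo] --> kappa C.
  apply: kcvg; apply/uniform_cvgP => d d0; near=> n => p up.
  have [/(_ p up) h _] := CP n; apply: lt_trans h _.
  by near: n; exact: near_infty_natSinv_lt (PosNum d0).
move=> /cvgrPdist_lt/(_ e e0)[n _ /(_ n (leqnn n))] /=.
by have [_] := CP n.
Unshelve. all: by end_near. Qed.

End copula_topology.

(** * The canonical polarization *)

Section polarization.
Context {R : realType}.
Variable kappa : copula R -> R.
Implicit Types (C D E : copula R).

Lemma cop_midC C D : cop_mid C D = cop_mid D C.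
Proof. by apply: copula_ext => p _; rewrite !cop_midE addrC. Qed.

Lemma polarizationC C D : polarization kappa C D = polarization kappa D C.
Proof. by rewrite /polarization cop_midC (addrC (kappa C)). Qed.

Lemma polarization_diag C : polarization kappa C C = kappa C.
Proof.
rewrite /polarization (_ : cop_mid C C = C); first by lra.
by apply: copula_ext => p _; rewrite cop_midE; lra.
Qed.

Hypothesis deg2 : degree_le2 kappa.

(** A polynomial of degree at most two is fixed by its values at 0, 1/2 and 1; the value at 1/2
    enters through the polarization. *)
Lemma kappa_conv t (t01 : 0 <= t <= 1) C D : kappa (cop_conv t01 C D) =
  (1 - t) ^+ 2 * kappa C + 2 * t * (1 - t) * polarization kappa C D + t ^+ 2 * kappa D.
Proof.
have [p [sp pE]] := deg2 C D.
have z01 : 0 <= (0 : R) <= 1 by lra.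
have o01 : 0 <= (1 : R) <= 1 by lra.
have pt x : p.[x] = p`_0 + p`_1 * x + p`_2 * x ^+ 2.
  by rewrite (horner_coef_wide _ sp) !big_ord_recl big_ord0 /= addr0 expr0 mulr1 expr1 addrA.
have p0 : kappa C = p.[0].
  by rewrite -(pE _ z01); congr kappa; apply: copula_ext => q _ /=; ring.
have p1 : kappa D = p.[1].
  by rewrite -(pE _ o01); congr kappa; apply: copula_ext => q _ /=; ring.
rewrite /polarization /cop_mid !pE p0 p1 !pt; by field.
Qed.

(* The third-order part of [kappa] on the triangle [C, D, E] is determined by
   its values at the two interior points with barycentric coordinates
   [(1/3, 1/3, 1/3)] and [(1/4, 1/4, 1/2)], and it vanishes because both lie on
   the segment from [E] to the midpoint of [C] and [D]. *)
Lemma polarization_conv t (t01 : 0 <= t <= 1) C D E :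
  polarization kappa C (cop_conv t01 D E) =
  (1 - t) * polarization kappa C D + t * polarization kappa C E.
Proof.
(* The coefficient of [2 * s * (1 - s)] found by expanding [kappa] along the segment from
   [cop_mid C D] to [cop_mid C E]. Affinity amounts to [g] being the mean of the two end values. *)
pose g := 2 * (polarization kappa (cop_mid C D) (cop_mid C E) - polarization kappa D E / 4)
          - kappa C / 2.
have b_t s (s01 : 0 <= s <= 1) : polarization kappa C (cop_conv s01 D E) =
    (1 - s) ^+ 2 * polarization kappa C D + s ^+ 2 * polarization kappa C E +
    2 * s * (1 - s) * g.
  have e : cop_mid C (cop_conv s01 D E) = cop_conv s01 (cop_mid C D) (cop_mid C E).
    by apply: copula_ext => p _ /=; ring.
  have := congr1 kappa e; rewrite /cop_mid !kappa_conv -/(cop_mid _ _) -/(cop_mid _ _).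
  by rewrite /g; lra.
have q13 : 0 <= (1 / 3 : R) <= 1 by lra.
have q12 : 0 <= (1 / 2 : R) <= 1 by lra.
have q23 : 0 <= (2 / 3 : R) <= 1 by lra.
have q34 : 0 <= (3 / 4 : R) <= 1 by lra.
have e1 : cop_conv q13 (cop_mid C D) E = cop_conv q23 C (cop_conv q12 D E).
  by apply: copula_ext => p _ /=; field.
have e2 : cop_conv q12 (cop_mid C D) E = cop_conv q34 C (cop_conv q23 D E).
  by apply: copula_ext => p _ /=; field.
have := congr1 kappa e1; have := congr1 kappa e2.
rewrite /cop_mid !kappa_conv !b_t => h1 h2; rewrite -/(cop_mid C D) in h1 h2.
have gE : g = (polarization kappa C D + polarization kappa C E) / 2 by lra.
by rewrite gE; field.
Qed.

Hypothesis kle : forall C D, cop_le C D -> kappa C <= kappa D.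

(** Near [C] the polarization governs the term of order [t] in [kappa_conv]. A drop from [D] to [E]
    would outweigh the gain of order [t ^+ 2] for small [t], against the monotonicity of [kappa]. *)
Lemma polarization_le C D E : cop_le D E -> polarization kappa C D <= polarization kappa C E.
Proof.
move=> DE; rewrite leNgt; apply/negP => lt.
set b := polarization kappa C D in lt *; set b' := polarization kappa C E in lt *.
have k0 : 0 <= kappa E - kappa D by rewrite subr_ge0 kle.
pose d := b - b'; have d0 : 0 < d by rewrite subr_gt0.
(* This gives [t <= 1 / 2] and [t * (kappa E - kappa D) <= d / 2], while monotonicity would force
   [2 * (1 - t) * d] below the latter product. *)
pose t := d / (2 * (d + (kappa E - kappa D))).
have den0 : 0 < 2 * (d + (kappa E - kappa D)) by lra.
have t0 : 0 < t by rewrite divr_gt0.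
have t12 : t <= 2^-1 by rewrite ler_pdivrMr//; lra.
have t01 : 0 <= t <= 1 by lra.
have /kle : cop_le (cop_conv t01 C D) (cop_conv t01 C E).
  by move=> p up /=; rewrite lerD2l ler_wpM2l ?(ltW t0)// DE.
rewrite !kappa_conv -/b -/b' => h.
have h' : t * (2 * (1 - t) * d) <= t * (t * (kappa E - kappa D)) by rewrite /d; lra.
rewrite ler_pM2l// in h'.
have : t * (kappa E - kappa D) <= d / 2.
  rewrite /t mulrAC ler_pdivrMr//; have := mulr_ge0 (ltW d0) (ltW d0); lra.
have : (1 - t) * d >= d / 2 by rewrite [leRHS]mulrC ler_wpM2l ?(ltW d0)//; lra.
by lra.
Qed.

Hypothesis kcvg : forall (C_ : nat -> copula R) C,
  {uniform unit_square, (fun n => C_ n : R * R -> R) @ \oo --> (C : R * R -> R)} ->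
  kappa (C_ n) @[n --> \oo] --> kappa C.

Lemma polarization_cvg D (C_ : nat -> copula R) C :
  {uniform unit_square, (fun n => C_ n : R * R -> R) @ \oo --> (C : R * R -> R)} ->
  polarization kappa D (C_ n) @[n --> \oo] --> polarization kappa D C.
Proof.
move=> cC; have cm : {uniform unit_square,
    (fun n => cop_mid D (C_ n) : R * R -> R) @ \oo --> (cop_mid D C : R * R -> R)}.
  apply/uniform_cvgP => e e0; have /uniform_cvgP/(_ e e0) := cC.
  apply: filterS => n h p up; apply: le_lt_trans (h p up); rewrite !cop_midE.
  rewrite (_ : _ - _ = 2^-1 * (C p - C_ n p)); last by field.
  by rewrite normrM ger0_norm ?invr_ge0// ler_piMl//; lra.
apply: cvgB; first by apply: cvgMr; exact: kcvg.
by apply: cvgMl; apply: cvgD; [exact: cvg_cst|exact: kcvg].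
Qed.

End polarization.

(** * Convex combinations and images of measures *)

Section measure_operations.
Context {R : realType}.
Implicit Types (C D E : copula R) (m : {measure set (R * R) -> \bar R}).

Let mS := @measurable_open_square R.

Let mCD C D : measurable_fun open_square (fun p => (C p - D p)%:E).
Proof.
have mCD' : measurable_fun open_square (fun p => C p - D p).
  by apply: measurable_funB; exact: cop_measurable.
exact/measurable_EFinP.
Qed.

Let CD0 C D : cop_le D C -> forall p, open_square p -> (0 <= (C p - D p)%:E)%E.
Proof. by move=> DC p /open_unit up; rewrite lee_fin subr_ge0; exact: DC. Qed.

Let int_copW m C D : weighted_measure m -> int_cop C m - int_cop D m =
  fine (\int[m]_(p in open_square) (C p - D p)%:E)%E.
Proof. by move=> wm; rewrite int_copB. Qed.

Lemma conv_measure t (t01 : 0 <= t <= 1) m1 m2 :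
  exists m : {measure set (R * R) -> \bar R},
    forall A, m A = ((1 - t)%:E * m1 A + t%:E * m2 A)%E.
Proof.
have t0 : 0 <= t by lra.
have s0 : 0 <= 1 - t by lra.
by exists (measure_add (mscale (NngNum s0) m1) (mscale (NngNum t0) m2)) => A; exact: measure_addE.
Qed.

(** As [D - Pi] has no fixed sign, the identity is first shown for ordered pairs, by non-negative
    integrals, and then for [D - W] and [Pi - W], whose difference gives the claim. *)
Lemma int_cop_conv_measure t (t01 : 0 <= t <= 1) m1 m2 m :
  weighted_measure m1 -> weighted_measure m2 ->
  (forall A, measurable A -> m A = ((1 - t)%:E * m1 A + t%:E * m2 A)%E) ->
  weighted_measure m /\
  forall D, int_cop D m = (1 - t) * int_cop D m1 + t * int_cop D m2.
Proof.
move=> w1 w2 mE; have t0 : 0 <= t by lra.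
have s0 : 0 <= 1 - t by lra.
have intE C D : cop_le D C -> (\int[m]_(p in open_square) (C p - D p)%:E =
    ((1 - t) * (int_cop C m1 - int_cop D m1) + t * (int_cop C m2 - int_cop D m2))%:E)%E.
  move=> DC; have f0 := CD0 DC; rewrite EFinD 2!EFinM -(int_copB C D w1) -(int_copB C D w2).
  rewrite -(ge0_integral_mscale m1 mS (NngNum s0) (mCD C D) f0).
  rewrite -(ge0_integral_mscale m2 mS (NngNum t0) (mCD C D) f0).
  rewrite -ge0_integral_measure_add//.
  by apply: eq_measure_integral => A mA _; rewrite mE//; apply/esym; exact: measure_addE.
have wm : weighted_measure m.
  have [n1 _] := w1; have [n2 _] := w2; split.
    rewrite mE ?n1 ?n2 ?mule0 ?adde0//; exact: measurableC.
  by rewrite /cop_w intE ?ltry//; exact: cop_geW.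
split => // D.
have := int_copW D cop_W wm; have := int_copW cop_Pi cop_W wm.
rewrite !intE /=; [|exact: cop_geW|exact: cop_geW].
by rewrite !int_cop_Pi; lra.
Qed.

Let push_integral m m' g (f : R * R -> \bar R) : measurable_fun setT g ->
  (forall p, open_square (g p) <-> open_square p) ->
  (forall A, measurable A -> m' A = pushforward m g A) ->
  measurable_fun open_square f -> (forall p, open_square p -> 0 <= f p)%E ->
  (\int[m']_(p in open_square) f p = \int[m]_(p in open_square) f (g p))%E.
Proof.
move=> mg gS mE mf f0.
have preS : g @^-1` open_square = open_square by apply/seteqP; split=> p /gS.
rewrite -[in RHS]preS -[RHS](ge0_integral_pushforward mg m mS mf); last first.
  by move=> p; rewrite inE; exact: f0.
by apply: eq_measure_integral => A mA _; rewrite mE.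
Qed.

Let push_null m m' g : measurable_fun setT g ->
  (forall p, open_square (g p) <-> open_square p) ->
  (forall A, measurable A -> m' A = pushforward m g A) ->
  m (~` open_square) = 0%E -> m' (~` open_square) = 0%E.
Proof.
move=> mg gS mE m0; rewrite mE; last exact: measurableC.
rewrite /pushforward (_ : g @^-1` _ = ~` open_square)//.
by apply/seteqP; split=> p /= np; apply: contra_not np => /gS.
Qed.

Lemma int_cop_push_swap m m' : weighted_measure m ->
  (forall A, measurable A -> m' A = pushforward m swap_sym A) ->
  weighted_measure m' /\ forall D, int_cop D m' = int_cop (cop_swap D) m.
Proof.
move=> wm mE; have mg := @measurable_swap_sym R.
have gS (p : R * R) : open_square (swap_sym p) <-> open_square p.
  by split=> -[? ?]; split.
have intE C D : cop_le D C -> (\int[m']_(p in open_square) (C p - D p)%:E =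
    (int_cop (cop_swap C) m - int_cop (cop_swap D) m)%:E)%E.
  move=> DC; rewrite (push_integral mg gS mE (mCD C D) (CD0 DC)).
  by rewrite -int_copB.
have wm' : weighted_measure m'.
  split; first by apply: push_null mg gS mE _; case: wm.
  by rewrite /cop_w intE ?ltry//; exact: cop_geW.
split => // D.
have := int_copW D cop_W wm'; have := int_copW cop_Pi cop_W wm'.
rewrite !intE /=; [|exact: cop_geW|exact: cop_geW].
by rewrite cop_swap_Pi !int_cop_Pi; lra.
Qed.

(** The sign appears because flipping reverses the order: [C - D] composed with the flip is
    [cop_flip D - cop_flip C]. *)
Lemma int_cop_push_flip m m' : weighted_measure m ->
  (forall A, measurable A -> m' A = pushforward m flip_sym A) ->
  weighted_measure m' /\ forall D, int_cop D m' = - int_cop (cop_flip D) m.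
Proof.
move=> wm mE; have mg := @measurable_flip_sym R.
have gS (p : R * R) : open_square (flip_sym p) <-> open_square p.
  by split=> -[/= ? ?]; split => //=; lra.
have intE C D : cop_le D C -> (\int[m']_(p in open_square) (C p - D p)%:E =
    (int_cop (cop_flip D) m - int_cop (cop_flip C) m)%:E)%E.
  move=> DC; rewrite (push_integral mg gS mE (mCD C D) (CD0 DC)).
  rewrite -int_copB//; apply: eq_integral => -[u v]; rewrite inE => /open_unit[u01 v01].
  by rewrite !cop_flipE// /flip_sym /=; congr EFin; ring.
have wm' : weighted_measure m'.
  split; first by apply: push_null mg gS mE _; case: wm.
  by rewrite /cop_w intE ?ltry//; exact: cop_geW.
split => // D.
have := int_copW D cop_W wm'; have := int_copW cop_Pi cop_W wm'.
rewrite !intE /=; [|exact: cop_geW|exact: cop_geW].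
by rewrite cop_flip_Pi !int_cop_Pi; lra.
Qed.

End measure_operations.

(** * From admissible fields to measures of concordance *)

Section field_to_concordance.
Context {R : realType}.
Variable nu : copula R -> {measure set (R * R) -> \bar R}.
Hypothesis adm : admissible nu.
Implicit Types (C D E : copula R).

Let wm C : weighted_measure (nu C) := adm_weighted adm C.

(** Its diagonal is [zeta nu]; being symmetric and affine in each argument, it turns out to be the
    polarization of [zeta nu]. *)
Definition field_form C D := int_cop C (nu cop_Pi) + int_cop D (nu C).

Lemma field_formC C D : field_form C D = field_form D C.
Proof. by have := adm_sym adm C D; rewrite /field_form; lra. Qed.

Lemma field_form_convr t (t01 : 0 <= t <= 1) C D E :
  field_form E (cop_conv t01 C D) = (1 - t) * field_form E C + t * field_form E D.
Proof. by rewrite /field_form int_cop_conv//; ring. Qed.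

Lemma field_form_convl t (t01 : 0 <= t <= 1) C D E :
  field_form (cop_conv t01 C D) E = (1 - t) * field_form C E + t * field_form D E.
Proof. by rewrite field_formC field_form_convr !(field_formC E). Qed.

Lemma zeta_conv t (t01 : 0 <= t <= 1) C D : zeta nu (cop_conv t01 C D) =
  (1 - t) ^+ 2 * zeta nu C + 2 * t * (1 - t) * field_form C D + t ^+ 2 * zeta nu D.
Proof.
rewrite -[LHS]/(field_form _ _) field_form_convl !field_form_convr (field_formC D C).
by rewrite -![zeta nu _]/(field_form _ _); ring.
Qed.

Lemma zeta_polarization C D : polarization (zeta nu) C D = field_form C D.
Proof. by rewrite /polarization /cop_mid zeta_conv; field. Qed.

Lemma zeta_degree : degree_le2 (zeta nu).
Proof.
move=> C D; exists (Poly [:: zeta nu C; 2 * (field_form C D - zeta nu C);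
  zeta nu C - 2 * field_form C D + zeta nu D]); split; first exact: size_Poly.
by move=> t t01; rewrite zeta_conv horner_Poly /=; ring.
Qed.

(** The form increases in its second argument; by symmetry one passes from [(C, C)] through
    [(C, D)], equal to [(D, C)], to [(D, D)]. *)
Lemma zeta_le C D : cop_le C D -> zeta nu C <= zeta nu D.
Proof.
move=> CD; have := le_int_cop (wm C) CD; have := le_int_cop (wm D) CD.
by have := field_formC C D; rewrite /field_form /zeta; lra.
Qed.

Lemma zeta_swap C : zeta nu (cop_sym swap_sym C) = zeta nu C.
Proof.
have sw E D : int_cop D (nu (cop_swap E)) = int_cop (cop_swap D) (nu E).
  apply: (int_cop_push_swap (wm E) _).2 => A mA.
  by rewrite -cop_sym_swap (adm_D4 adm)//; exact: D4_swap.
(* [Pi] is its own swap, so [sw] also handles the term with [nu cop_Pi]. *)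
by rewrite cop_sym_swap /zeta -{1}cop_swap_Pi !sw !cop_swapK.
Qed.

Lemma zeta_flip C : zeta nu (cop_sym flip_sym C) = - zeta nu C.
Proof.
have fl E D : int_cop D (nu (cop_flip E)) = - int_cop (cop_flip D) (nu E).
  apply: (int_cop_push_flip (wm E) _).2 => A mA.
  by rewrite -cop_sym_flip (adm_D4 adm)//; exact: D4_flip.
by rewrite cop_sym_flip /zeta -{1}cop_flip_Pi !fl !cop_flipK opprD.
Qed.

Lemma zeta_concordance : concordance_measure (zeta nu).
Proof.
split.
- exact: zeta_swap.
- exact: zeta_le.
- exact: (adm_norm adm).
- exact: zeta_flip.
- move=> C_ C cC; apply: continuous_cvg; first exact: (adm_continuous adm).
  exact: cvg_copula.
Qed.

Lemma zeta_represents : represents nu (zeta nu).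
Proof. exact: zeta_polarization. Qed.

End field_to_concordance.

(** * From measures of concordance to admissible fields *)

Section concordance_to_field.
Context {R : realType}.
Variable kappa : copula R -> R.
Hypothesis conc : concordance_measure kappa.
Hypothesis deg2 : degree_le2 kappa.
Implicit Types (C D E : copula R).

Let b := polarization kappa.

Lemma polarization_swap C D : b (cop_swap C) (cop_swap D) = b C D.
Proof.
have ks E : kappa (cop_swap E) = kappa E by rewrite -cop_sym_swap (conc_swap conc).
by rewrite /b /polarization /cop_mid -cop_swap_conv !ks.
Qed.

Lemma polarization_flip C D : b (cop_flip C) (cop_flip D) = - b C D.
Proof.
have ks E : kappa (cop_flip E) = - kappa E by rewrite -cop_sym_flip (conc_flip conc).
by rewrite /b /polarization /cop_mid -cop_flip_conv !ks; field.
Qed.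

Let rep C : exists m : {measure set (R * R) -> \bar R},
  [/\ weighted_measure m, forall D, int_cop D m = b C D - b C cop_Pi &
      forall nu, weighted_measure nu -> (forall D, int_cop D nu = b C D - b C cop_Pi) ->
        forall A, measurable A -> nu A = m A].
Proof.
apply: representation.
- by move=> t t01 D E; exact: polarization_conv.
- by move=> D E; apply: polarization_le => //; exact: conc_le conc.
- by move=> D_ D; apply: polarization_cvg; exact: conc_cvg conc.
Qed.

Theorem concordance_field : exists nu : copula R -> {measure set (R * R) -> \bar R},
  unique_field_of kappa nu.
Proof.
have [nu nuP] := choice rep.
have wm C : weighted_measure (nu C) by have [] := nuP C.
have intE C D : int_cop D (nu C) = b C D - b C cop_Pi by have [_ ->] := nuP C.
have uniq C (m : {measure set (R * R) -> \bar R}) : weighted_measure m ->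
    (forall D, int_cop D m = b C D - b C cop_Pi) ->
    forall A, measurable A -> m A = nu C A by have [_ _] := nuP C; exact.
(* [Pi] is invariant under the flip. Hence the [nu cop_Pi] term is [b cop_Pi C], exactly what each
   representing measure subtracts. *)
have kPi : kappa cop_Pi = 0.
  by have := conc_flip conc cop_Pi; rewrite cop_sym_flip cop_flip_Pi; lra.
have bPi : b cop_Pi cop_Pi = 0 by rewrite /b polarization_diag.
have reps : represents nu kappa.
  by move=> C D; rewrite !intE bPi -/(b C D) /b (polarizationC _ cop_Pi); lra.
have zetaE C : zeta nu C = kappa C.
  by rewrite -(polarization_diag kappa C) reps.
have pushS C (m : {measure set (R * R) -> \bar R}) :
    (forall A, measurable A -> m A = pushforward (nu C) swap_sym A) ->
    forall A, measurable A -> m A = nu (cop_swap C) A.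
  move=> mE; have [wm' intm] := int_cop_push_swap (wm C) mE; apply: uniq => // D.
  rewrite intm intE -polarization_swap cop_swapK; congr (_ - _).
  by rewrite -polarization_swap cop_swap_Pi.
(* The sign from flipping the integrand cancels the sign from [polarization_flip]. *)
have pushF C (m : {measure set (R * R) -> \bar R}) :
    (forall A, measurable A -> m A = pushforward (nu C) flip_sym A) ->
    forall A, measurable A -> m A = nu (cop_flip C) A.
  move=> mE; have [wm' intm] := int_cop_push_flip (wm C) mE; apply: uniq => // D.
  have := polarization_flip C (cop_flip D); have := polarization_flip C cop_Pi.
  by rewrite cop_flip_Pi cop_flipK intm intE; lra.
have D4P g : D4 g -> forall C A, measurable A -> nu (cop_sym g C) A = pushforward (nu C) g A.
  elim=> [C A mA|C A mA|C A mA|g1 g2 D1 IH1 D2 IH2 C A mA].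
  - by rewrite cop_sym_id.
  - have [m mE] := pushforward_measure (nu C) (@measurable_swap_sym R).
    by rewrite cop_sym_swap -(pushS C m)// mE.
  - have [m mE] := pushforward_measure (nu C) (@measurable_flip_sym R).
    by rewrite cop_sym_flip -(pushF C m)// mE.
  - rewrite cop_sym_comp// IH1// /pushforward IH2//.
    by apply: measurable_preimage => //; exact: measurable_D4.
have adm : admissible nu.
  split => //.
  - move=> C D t t01 A mA; have [m mE] := conv_measure t01 (nu C) (nu D).
    have [wm' intm] := int_cop_conv_measure t01 (wm C) (wm D) (fun A _ => mE A).
    rewrite -mE; apply/esym; apply: uniq => // E.
    rewrite intm !intE /b !(polarizationC _ (cop_conv _ _ _)) !polarization_conv//.
    by rewrite !(polarizationC _ E) !(polarizationC _ cop_Pi); ring.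
  - move=> C D; rewrite !intE /b (polarizationC _ D C).
    by rewrite !(polarizationC _ cop_Pi); ring.
  - move=> C g Dg A mA; exact: D4P.
  - rewrite (_ : zeta nu = kappa); last exact/funext.
    exact/sequential_continuous/(conc_cvg conc).
  - by rewrite zetaE (conc_M conc).
exists nu; split => // nu' adm' reps' C A mA.
(* Subtracting the representation at [Pi] removes the [nu' cop_Pi] term and leaves the defining
   property of [nu C]. *)
apply: uniq => // [|D]; first exact: (adm_weighted adm').
have := reps' C D; have := reps' C cop_Pi; rewrite -/b int_cop_Pi => -> ->; lra.
Qed.

End concordance_to_field.

Theorem theorem3p7 (R : realType) :
  (forall kappa : copula R -> R,
     concordance_measure kappa -> degree_le2 kappa ->
     exists nu : copula R -> {measure set (R * R) -> \bar R},
       unique_field_of kappa nu) /\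
  (forall nu : copula R -> {measure set (R * R) -> \bar R},
     admissible nu ->
     [/\ concordance_measure (zeta nu), degree_le2 (zeta nu),
         represents nu (zeta nu) & unique_field_of (zeta nu) nu]).
Proof.
split=> [kappa conc deg2|nu adm]; first exact: concordance_field.
have conc := zeta_concordance adm; have deg2 := zeta_degree adm.
have reps := zeta_represents adm.
split => //; split => // nu' adm' reps' C A mA.
(* Both [nu'] and [nu] coincide with the field constructed from [zeta nu]. *)
have [nu0 [_ _ uniq0]] := concordance_field conc deg2.
by rewrite (uniq0 _ adm' reps')// (uniq0 _ adm reps).
Qed.
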